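(* Let $f\colon I\to\mathbb{R}$ be a convex, continuous function defined on an interval $I\subseteq\mathbb{R}$ and let $\mathcal{A}$ be a $C^*$-algebra with a finite trace $\tau$. Then the inequality $$\tau\left(f\left(\sum_{i=1}^n a_i^*x_ia_i\right)\right)\le\tau\left(\sum_{i=1}^n a_i^*f(x_i)a_i\right)$$ is valid for every $n\ge 1$, every $n$-tuple $(x_1,\dots,x_n)$ of self-adjoint elements of $\mathcal{A}$ with spectra contained in $I$, and every $n$-tuple $(a_1,\dots,a_n)$ in $\mathcal{A}$ with $\sum_{k=1}^n a_k^*a_k=\mathbf{1}$. If the trace $\tau$ is unbounded, but lower semi-continuous and densely defined, the inequality is still valid (for all such tuples) if $f\ge 0$, although now some of the numbers may be infinite.
   Context: $\mathbf{1}$ is the unit (the condition $\sum_k a_k^*a_k=\mathbf{1}$ with $a_k\in\mathcal{A}$ presupposes that $\mathcal{A}$ contains it). For self-adjoint $x\in\mathcal{A}$ with spectrum in $I$, $f(x)$ is defined by continuous functional calculus. A finite trace on $\mathcal{A}$ is a positive linear functional $\tau$ with $\tau(xy)=\tau(yx)$ for all $x,y\in\mathcal{A}$. In the unbounded case, a trace is an additive, positively homogeneous map $\tau\colon\mathcal{A}_+\to[0,\infty]$ with $\tau(x^*x)=\tau(xx^* )$ for all $x\in\mathcal{A}$; it is densely defined if it is finite on a dense subset of $\mathcal{A}_+$. *)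

(* Defs.v *)
From HB Require Import structures.
From mathcomp Require Import all_boot all_order all_algebra.
From mathcomp Require Import all_classical all_reals all_analysis.
From mathcomp Require Import complex.

Set Implicit Arguments.
Unset Strict Implicit.
Unset Printing Implicit Defensive.

Import Order.TTheory GRing.Theory Num.Theory.
Import numFieldNormedType.Exports.

Local Open Scope classical_set_scope.
Local Open Scope ring_scope.
Local Open Scope complex_scope.

(* Unital complex C*-algebras: a complex Banach space (the norm is the R[i]-valued
   norm of MathComp-Analysis, hence real and nonnegative) with a product and an
   involution.  The product is part of the mixin because Hierarchy Builder
   rejects the join of a ring structure with a normed module (no common join
   below numDomainType); the ring structure is recovered as a canonical
   instance just after, so that 1, x * y, x ^+ n are the generic ring
   operations.  As in the literature, the zero algebra is allowed, which is why
   the instance is a pzRingType. *)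
HB.mixin Record isCStarAlgebra (R : realType) A
    of CompleteNormedModule R[i] A := {
  cone : A ;
  cmul : A -> A -> A ;
  cmulA : associative cmul ;
  cmul1x : left_id cone cmul ;
  cmulx1 : right_id cone cmul ;
  cmulDl : left_distributive cmul +%R ;
  cmulDr : right_distributive cmul +%R ;
  cscaleAl : forall (k : R[i]) (x y : A), k *: cmul x y = cmul (k *: x) y ;
  cscaleAr : forall (k : R[i]) (x y : A), k *: cmul x y = cmul x (k *: y) ;
  star : A -> A ;
  starD : forall x y : A, star (x + y) = star x + star y ;
  starZ : forall (k : R[i]) (x : A), star (k *: x) = k^* *: star x ;
  starM : forall x y : A, star (cmul x y) = cmul (star y) (star x) ;
  starK : involutive star ;
  cnormM : forall x y : A, `|cmul x y| <= `|x| * `|y| ;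
  cnorm_star : forall x : A, `|cmul (star x) x| = `|x| ^+ 2
}.

#[short(type="cstarAlgType")]
HB.structure Definition CStarAlgebra (R : realType) :=
  {A of CompleteNormedModule R[i] A & isCStarAlgebra R A}.

HB.instance Definition _ (R : realType) (A : cstarAlgType R) :=
  GRing.Zmodule_isPzRing.Build (CStarAlgebra.sort A)
    cmulA cmul1x cmulx1 cmulDl cmulDr.

Section CStarAlgebraDefs.
Context {R : realType} {A : cstarAlgType R}.
Implicit Types (x y : A) (f : R -> R).

Definition selfadjoint x : Prop := star x = x.

Definition cinvertible x : Prop := exists y : A, x * y = 1 /\ y * x = 1.

Definition spectrum x : set R[i] :=
  [set z | ~ cinvertible (z *: (1 : A) - x)].

Definition spectrum_in x (I : set R) : Prop :=
  spectrum x `<=` [set t%:C | t in I].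

Definition cpos : set A :=
  [set x | selfadjoint x /\ spectrum_in x [set t | 0 <= t]].

(* R[i]^o carries the usual topology of the complex plane. *)
Definition spectrum_continuous x (g : R[i] -> R[i]) : Prop :=
  {within (spectrum x : set R[i]^o), continuous (g : R[i]^o -> R[i]^o)}.

(* Phi is a unital *-homomorphism from C(spectrum x) to A sending the identity
   function to x.  Elements of C(spectrum x) are represented by total functions
   whose restriction to the spectrum is continuous, identified when they agree
   there. *)
Record functional_calculus x (Phi : (R[i] -> R[i]) -> A) : Prop := {
  fcal_ext : forall g h : R[i] -> R[i],
    spectrum_continuous x g -> spectrum_continuous x h ->
    {in spectrum x, g =1 h} -> Phi g = Phi h ;
  fcal_add : forall g h : R[i] -> R[i],
    spectrum_continuous x g -> spectrum_continuous x h ->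
    Phi (fun z => g z + h z) = Phi g + Phi h ;
  fcal_scale : forall (k : R[i]) (g : R[i] -> R[i]),
    spectrum_continuous x g ->
    Phi (fun z => k * g z) = k *: Phi g ;
  fcal_mul : forall g h : R[i] -> R[i],
    spectrum_continuous x g -> spectrum_continuous x h ->
    Phi (fun z => g z * h z) = Phi g * Phi h ;
  fcal_star : forall g : R[i] -> R[i],
    spectrum_continuous x g ->
    Phi (fun z => (g z)^*) = star (Phi g) ;
  fcal_one : Phi (fun _ => 1) = 1 ;
  fcal_id : Phi id = x
}.

(* f(x), for x self-adjoint and f continuous on the (then real) spectrum of x.
   The value is junk outside of this situation. *)
Definition cfc f x : A :=
  xget 0 [set y | exists2 Phi, functional_calculus x Phi &
                    y = Phi (fun z => (f (complex.Re z))%:C)].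

Definition finite_trace (tau : {scalar A}) : Prop :=
  (forall x, cpos x -> 0 <= tau x) /\
  (forall x y, tau (x * y) = tau (y * x)).

(* A trace with values in [0, +oo]; only its restriction to A_+ is relevant. *)
Record ext_trace (tau : A -> \bar R) : Prop := {
  ext_trace_ge0 : forall x, cpos x -> (0 <= tau x)%E ;
  ext_traceD : forall x y, cpos x -> cpos y ->
    tau (x + y) = (tau x + tau y)%E ;
  ext_traceZ : forall (t : R) x, 0 <= t -> cpos x ->
    tau (t%:C *: x) = (t%:E * tau x)%E ;
  ext_trace_star : forall x, tau (star x * x) = tau (x * star x)
}.

(* The subspace topology makes this lower semicontinuity on A_+ only: points
   outside of A_+ are isolated. *)
Definition lsc_trace (tau : A -> \bar R) : Prop :=
  lower_semicontinuous (tau : subspace cpos -> \bar R).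

Definition densely_defined (tau : A -> \bar R) : Prop :=
  cpos `<=` closure [set x | cpos x /\ (tau x < +oo)%E].

End CStarAlgebraDefs.

(* Main.v *)
Require Import Defs.
From HB Require Import structures.
From mathcomp Require Import all_boot all_order all_algebra.
From mathcomp Require Import all_classical all_reals all_analysis.
From mathcomp Require Import complex.
From mathcomp Require Import ring lra.

Set Implicit Arguments.
Unset Strict Implicit.
Unset Printing Implicit Defensive.

Import Order.TTheory GRing.Theory Num.Theory.
Import numFieldNormedType.Exports.

Local Open Scope classical_set_scope.
Local Open Scope ring_scope.
Local Open Scope complex_scope.

(** Write y for the sum of the elements a_i^* x_i a_i and b for the sum of the
elements a_i^* f(x_i) a_i.

An affine function l commutes with the averaging that forms y, because the
a_i^* a_i add up to 1.  Hence, for every affine minorant l of f on an interval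
[m, M] containing all the spectra, b - l(y) is the sum of the elements
a_i^* (f - l)(x_i) a_i and so is positive: b dominates l(y) for each l
separately.  In general b does not dominate the supremum f(y) of the l(y); a
trace makes up for it.  If u_j are selfadjoint with squares adding up to 1, then
the trace of b is the sum of the traces of the u_j b u_j ([cone_trace_pinching]),
so that one minorant l_j may be used in each summand.  Choose finitely many
affine minorants l_j such that every point of [m, M] has one of them within e of
f ([affine_minorants]), a continuous partition of unity h_j with
h_j (l_j - f + e) >= 0, and u_j the square root of h_j(y).  Then u_j b u_j
dominates u_j l_j(y) u_j, which dominates u_j (f(y) - e) u_j; summing the traces
gives tau(b) >= tau(f(y)) - e tau(1), and e is arbitrary
([trace_jensen_nonneg]).

Only the values on the positive cone enter here, so both halves of the theorem
are instances of one statement about finite traces on the cone.  For a finite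
trace, a constant is first added to f to make it nonnegative on [m, M].  For a
densely defined one, some positive z of finite trace satisfies |1 - z| < 1/2;
then 1 <= 2 z, so the unit, and with it every positive element, has finite
trace ([ext_trace_fin]).

The C*-algebra theory behind this is built from the norm axioms.  The key point
is that a selfadjoint a has |a| or -|a| in its spectrum ([spec_norm]).  It gives
the bound of |p(x)| by the supremum of |p| over the spectrum for polynomials p,
hence, with Weierstrass approximation on the spectrum, the existence of the
continuous functional calculus ([functional_calculus_ex]).  The value cfc f x is
read off some chosen calculus, and the argument uses only the algebraic laws
that every calculus satisfies.  It provides square roots of positive elements
([cpos_root]), and positivity of z^* z ([cpos_starM]) that of z^* b z for
positive b. *)

(** * The norm as a real number *)

Section RealNorm.
Context {R : realType}.
Implicit Types (k : R[i]) (t : R).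

(** The norm of a normed module over R[i] takes its values in R[i], where the
order is partial; its real part allows real arithmetic and decision procedures.
*)
Definition rn (V : normedZmodType R[i]) (x : V) : R := complex.Re `|x|.

Lemma rnE (V : normedZmodType R[i]) (x : V) : `|x| = (rn x)%:C.
Proof. by rewrite /rn RRe_real// ger0_real. Qed.

Lemma rn_ge0 (V : normedZmodType R[i]) (x : V) : 0 <= rn x.
Proof. by have := normr_ge0 x; rewrite rnE ler0c. Qed.

Lemma rn0 (V : normedZmodType R[i]) : rn (0 : V) = 0.
Proof. by rewrite /rn normr0. Qed.

Lemma rn_eq0 (V : normedZmodType R[i]) (x : V) : rn x = 0 -> x = 0.
Proof. by move=> h; apply/normr0_eq0; rewrite rnE h. Qed.

Lemma rnN (V : normedZmodType R[i]) (x : V) : rn (- x) = rn x.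
Proof. by rewrite /rn normrN. Qed.

Lemma rn_distC (V : normedZmodType R[i]) (x y : V) : rn (x - y) = rn (y - x).
Proof. by rewrite /rn distrC. Qed.

Lemma rnD (V : normedZmodType R[i]) (x y : V) : rn (x + y) <= rn x + rn y.
Proof. by rewrite -lecR rmorphD/= -!rnE ler_normD. Qed.

Lemma rn_sum (V : normedZmodType R[i]) (J : Type) (r : seq J) (P : pred J) (F : J -> V) :
  rn (\sum_(j <- r | P j) F j) <= \sum_(j <- r | P j) rn (F j).
Proof.
elim/big_rec2: _ => [|j y x _ h]; first by rewrite rn0.
by apply: le_trans (rnD _ _) _; rewrite lerD2l.
Qed.

Lemma rnR t : rn (t%:C) = `|t|.
Proof. by rewrite /rn normc_def/= expr0n/= addr0 sqrtr_sqr. Qed.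

Lemma rnCM (k l : R[i]) : rn (k * l) = rn k * rn l.
Proof. by apply: complexI; rewrite rmorphM/= -!rnE normrM. Qed.

Lemma rnZ (V : normedModType R[i]) k (x : V) : rn (k *: x) = rn k * rn x.
Proof. by apply: complexI; rewrite rmorphM/= -!rnE normrZ. Qed.

Lemma rn_sqrE k : rn k ^+ 2 = complex.Re k ^+ 2 + complex.Im k ^+ 2.
Proof. by apply: complexI; rewrite rmorphXn/= -rnE add_Re2_Im2. Qed.

Lemma conjR t : Num.conj (t%:C : R[i]) = t%:C.
Proof. exact: conjc_real. Qed.

Lemma rnJ k : rn (Num.conj k) = rn k.
Proof. by rewrite /rn !normc_def/=; case: k => a b /=; rewrite sqrrN. Qed.

Lemma rn_complete (V : completeNormedModType R[i]) (u : nat -> V) :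
  (forall e : R, 0 < e -> exists N, forall m n, (N <= m)%N -> (N <= n)%N ->
     rn (u m - u n) < e) ->
  exists l, forall e : R, 0 < e -> exists N, forall n, (N <= n)%N ->
     rn (u n - l) < e.
Proof.
move=> hu.
have uC : cauchy (u @ \oo).
  apply/cauchyP => e e0.
  have eE : e = (complex.Re e)%:C by rewrite RRe_real// gtr0_real.
  have e0' : 0 < complex.Re e by rewrite -(ltcR 0) -eE.
  have [N hN] := hu _ e0'.
  exists (u N); exists N => // n /= Nn.
  by rewrite -ball_normE/= rnE eE ltcR; apply: hN.
have /cauchy_cvgP/cvg_ex[/= l ul] := uC.
exists l => e e0.
have := ul _ (@nbhsx_ballx _ _ l (e%:C) _).
rewrite ltcR => /(_ e0) [N _ hN]; exists N => n Nn.
by have := hN _ Nn; rewrite /= -ball_normE/= rnE ltcR rn_distC.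
Qed.

Lemma geo_small (q C e : R) : 0 <= q < 1 -> 0 < e -> exists n, C * q ^+ n < e.
Proof.
move=> /andP[q0 q1] e0.
have h : (fun n => C * q ^+ n) @ \oo --> (0 : R).
  rewrite -(mulr0 C); apply: cvgM; first exact: cvg_cst.
  by apply: cvg_expr; rewrite ger0_norm.
have /cvgrPdist_lt/(_ _ e0) [N _ hN] := h.
exists N; have := hN N (leqnn N); rewrite sub0r normrN.
by apply: le_lt_trans; rewrite ler_norm.
Qed.

End RealNorm.

(** * Star operations and the Neumann series *)

Section Spectrum.
Context {R : realType} {A : cstarAlgType R}.
Implicit Types (x y z a c : A) (k : R[i]) (t : R).

Lemma mulZl k x y : (k *: x) * y = k *: (x * y).
Proof. by rewrite (cscaleAl k x y). Qed.

Lemma mulZr k x y : x * (k *: y) = k *: (x * y).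
Proof. by rewrite (cscaleAr k x y). Qed.

Lemma starB x y : star (x - y) = star x - star y.
Proof. by rewrite -scaleN1r starD starZ rmorphN1 scaleN1r. Qed.

Lemma star0 : star (0 : A) = 0.
Proof. by rewrite -(subrr 0) starB !subrr. Qed.

Lemma starMr x y : star (x * y) = star y * star x.
Proof. exact: starM. Qed.

Lemma star1 : star (1 : A) = 1.
Proof. by rewrite -[LHS]mulr1 -{2}(starK (1 : A)) -starMr mulr1 starK. Qed.

Lemma starZR t x : star (t%:C *: x) = t%:C *: star x.
Proof. by rewrite starZ conjR. Qed.

Lemma star_sum (J : Type) (r : seq J) (P : pred J) (F : J -> A) :
  star (\sum_(j <- r | P j) F j) = \sum_(j <- r | P j) star (F j).
Proof. by apply: big_morph; [exact: starD|exact: star0]. Qed.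

Lemma rnM x y : rn (x * y) <= rn x * rn y.
Proof. by rewrite -lecR rmorphM/= -!rnE; apply: cnormM. Qed.

Lemma rn_starM x : rn (star x * x) = rn x ^+ 2.
Proof. by apply: complexI; rewrite rmorphXn/= -!rnE; apply: cnorm_star. Qed.

(** The C*-identity gives |x|^2 <= |star x| |x|, hence |x| <= |star x|; the
involution gives the converse. *)
Lemma rn_star x : rn (star x) = rn x.
Proof.
have h y : rn y <= rn (star y).
  have := rnM (star y) y; rewrite rn_starM expr2.
  have := rn_ge0 y; rewrite le_eqVlt => /orP[/eqP <- _|y0]; first exact: rn_ge0.
  by rewrite ler_pM2r.
by apply/le_anti; rewrite h -{2}(starK x) h.
Qed.

Lemma rn1_le1 : rn (1 : A) <= 1.
Proof.
have := rn_starM (1 : A); rewrite star1 mulr1 => h.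
have := rn_ge0 (1 : A); move: h; move: (rn _) => t; nra.
Qed.

Lemma rnX x n : rn (x ^+ n) <= rn x ^+ n.
Proof.
elim: n => [|n IH]; first exact: rn1_le1.
rewrite !exprS; apply: le_trans (rnM _ _) _.
by apply: ler_wpM2l => //; apply: rn_ge0.
Qed.

Lemma saD x y : selfadjoint x -> selfadjoint y -> selfadjoint (x + y).
Proof. by rewrite /selfadjoint starD => -> ->. Qed.

Lemma saZ t x : selfadjoint x -> selfadjoint (t%:C *: x).
Proof. by rewrite /selfadjoint starZR => ->. Qed.

Lemma saN x : selfadjoint x -> selfadjoint (- x).
Proof. by move=> h; rewrite -scaleN1r -(rmorphN1 (real_complex R)); apply: saZ. Qed.

Lemma saB x y : selfadjoint x -> selfadjoint y -> selfadjoint (x - y).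
Proof. by move=> hx hy; apply: saD => //; apply: saN. Qed.

Lemma sa1 : selfadjoint (1 : A). Proof. exact: star1. Qed.

Lemma saC t : selfadjoint (t%:C *: (1 : A)). Proof. by apply: saZ; apply: sa1. Qed.

Lemma sa_sum (J : Type) (r : seq J) (P : pred J) (F : J -> A) :
  (forall j, P j -> selfadjoint (F j)) -> selfadjoint (\sum_(j <- r | P j) F j).
Proof. by move=> h; rewrite /selfadjoint star_sum; apply: eq_bigr. Qed.

Lemma sa_star x : selfadjoint (star x * x).
Proof. by rewrite /selfadjoint starMr starK. Qed.

Lemma saM x : selfadjoint x -> selfadjoint (x * x).
Proof. by rewrite /selfadjoint starMr => ->. Qed.

Lemma sa_conj x y : selfadjoint x -> selfadjoint (star y * x * y).
Proof. by rewrite /selfadjoint !starMr starK mulrA => ->. Qed.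

Lemma rn_sqr x : selfadjoint x -> rn (x * x) = rn x ^+ 2.
Proof. by move=> h; rewrite -[in RHS]rn_starM h. Qed.

Lemma geom_sumr (T : pzRingType) (x : T) n :
  (1 - x) * (\sum_(i < n) x ^+ i) = 1 - x ^+ n.
Proof.
elim: n => [|n IH]; first by rewrite big_ord0 mulr0 expr0 subrr.
by rewrite big_ord_recr/= mulrDr IH mulrBl mul1r -exprS addrA subrK.
Qed.

Lemma geom_suml (T : pzRingType) (x : T) n :
  (\sum_(i < n) x ^+ i) * (1 - x) = 1 - x ^+ n.
Proof.
elim: n => [|n IH]; first by rewrite big_ord0 mul0r expr0 subrr.
by rewrite big_ord_recr/= mulrDl IH mulrBr mulr1 -exprSr addrA subrK.
Qed.

Lemma neumann x : rn x < 1 -> cinvertible (1 - x).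
Proof.
move=> x1; pose q := rn x; have q0 : 0 <= q := rn_ge0 x.
have q01 : 0 <= q < 1 by rewrite q0.
have q1 : 0 < 1 - q by rewrite subr_gt0.
pose S n : A := \sum_(i < n) x ^+ i.
have bd n m : (n <= m)%N -> rn (S m - S n) <= (1 - q)^-1 * q ^+ n.
  move=> /subnKC <-; set p := (m - n)%N.
  have -> : S (n + p)%N - S n = x ^+ n * S p.
    rewrite /S big_split_ord/= addrAC subrr add0r mulr_sumr.
    by apply: eq_bigr => i _; rewrite exprD.
  have h : rn (S p) <= (1 - q)^-1.
    apply: le_trans (rn_sum _ _ _) _.
    apply: (@le_trans _ _ (\sum_(i < p) q ^+ i)).
      by apply: ler_sum => i _; apply: rnX.
    rewrite -(ler_pM2l q1) mulfV ?gt_eqF// geom_sumr.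
    by rewrite gerBl exprn_ge0.
  rewrite mulrC; apply: le_trans (rnM _ _) _.
  by apply: ler_pM; rewrite ?rn_ge0// rnX.
have [e e0|y hy] := @rn_complete R A S.
  have [N hN] := geo_small (2 * (1 - q)^-1) q01 e0.
  exists N => m n Nm Nn; apply: le_lt_trans hN.
  have -> : S m - S n = (S m - S N) + - (S n - S N) by rewrite opprB addrA subrK.
  apply: le_trans (rnD _ _) _; rewrite rnN.
  by rewrite mulr2n mulrDl mul1r mulrDl lerD// bd.
have q2 : 0 <= rn (1 - x) := rn_ge0 _.
have small e : 0 < e -> exists n, rn (S n - y) < e /\ rn (x ^+ n) < e.
  move=> e0; have [N hN] := hy e e0; have [M hM] := geo_small 1 q01 e0.
  exists (N + M)%N; rewrite hN ?leq_addr//; split => //.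
  apply: le_lt_trans (rnX _ _) _; apply: le_lt_trans hM.
  by rewrite mul1r exprD ler_piMl ?exprn_ge0 ?exprn_ile1// ltW.
have eq0 (w : A) : (forall e, 0 < e -> rn w <= (rn (1 - x) + 1) * e) -> w = 0.
  move=> h; apply: rn_eq0; apply/le_anti; rewrite rn_ge0 andbT.
  apply/ler_addgt0Pr => e e0; rewrite add0r.
  have p0 : 0 < rn (1 - x) + 1 by rewrite ltr_wpDl.
  have := h (e / (rn (1 - x) + 1)) (divr_gt0 e0 p0).
  by rewrite mulrCA divff ?gt_eqF// mulr1.
exists y; split; apply/subr0_eq/eq0 => e e0.
- have [n [h1 h2]] := small e e0.
  have -> : (1 - x) * y - 1 = - ((1 - x) * (S n - y)) - x ^+ n.
    by rewrite mulrBr geom_sumr !opprB addrA (addrAC _ (- 1)) addrK.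
  apply: le_trans (rnD _ _) _; rewrite !rnN [leRHS]mulrDl mul1r lerD ?(ltW h2)//.
  by apply: le_trans (rnM _ _) _; apply: ler_wpM2l (ltW h1).
- have [n [h1 h2]] := small e e0.
  have -> : y * (1 - x) - 1 = - ((S n - y) * (1 - x)) - x ^+ n.
    by rewrite mulrBl geom_suml !opprB addrA (addrAC _ (- 1)) addrK.
  apply: le_trans (rnD _ _) _; rewrite !rnN [leRHS]mulrDl mul1r lerD ?(ltW h2)//.
  by rewrite mulrC; apply: le_trans (rnM _ _) _; apply: ler_wpM2r => //; apply: ltW.
Qed.

End Spectrum.

(** * Spectrum, norm and the positive cone *)

Section Spectrum2.
Context {R : realType} {A : cstarAlgType R}.
Implicit Types (x y z a c h v w : A) (k l : R[i]) (t s : R).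

Local Notation sc k := (k *: (1 : A)).

Lemma cinvM x y : cinvertible x -> cinvertible y -> cinvertible (x * y).
Proof.
move=> [x' [h1 h2]] [y' [h3 h4]]; exists (y' * x'); split.
  by rewrite -mulrA (mulrA y) h3 mul1r.
by rewrite -mulrA (mulrA x') h2 mul1r.
Qed.

Lemma cinvZ k x : k != 0 -> cinvertible x -> cinvertible (k *: x).
Proof.
move=> k0 [y [h1 h2]]; exists (k^-1 *: y).
by rewrite !mulZl !mulZr !scalerA h1 h2 mulfV// mulVf// scale1r.
Qed.

Lemma cinvN x : cinvertible x -> cinvertible (- x).
Proof. by move=> h; rewrite -scaleN1r; apply: cinvZ => //; rewrite oppr_eq0 oner_eq0. Qed.

Lemma spec_le x k : spectrum x k -> rn k <= rn x.
Proof.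
move=> xk; rewrite leNgt; apply/negP => lt; apply: xk.
have k0 : k != 0.
  by apply/eqP => k0; move: lt; rewrite k0 rn0 ltNge rn_ge0.
have -> : sc k - x = k *: (1 - k^-1 *: x).
  by rewrite scalerBr scalerA mulfV// scale1r.
apply/cinvZ/neumann => //; rewrite rnZ.
have kp : 0 < rn k by apply: le_lt_trans lt; apply: rn_ge0.
have -> : rn k^-1 = (rn k)^-1.
  apply: (mulfI (lt0r_neq0 kp)); rewrite -rnCM !mulfV// ?gt_eqF//.
  by rewrite -[1]/((1 : R)%:C) rnR normr1.
by rewrite mulrC ltr_pdivrMr// mul1r.
Qed.

Lemma spec_sub x k l : spectrum (sc k - x) l <-> spectrum x (k - l).
Proof.
rewrite /spectrum/=.
have -> : sc l - (sc k - x) = - (sc (k - l) - x).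
  by rewrite scalerBl !opprB addrCA.
by split=> h /cinvN; rewrite ?opprK; apply: h.
Qed.

Lemma spec_shift x k l : spectrum x k -> spectrum (x + sc l) (k + l).
Proof.
rewrite /spectrum/=.
by rewrite scalerDl opprD addrACA subrr addr0.
Qed.

Lemma specZ x k l : l != 0 -> spectrum x k -> spectrum (l *: x) (l * k).
Proof.
rewrite /spectrum/= => l0 h; rewrite -scalerA -scalerBr => /(@cinvZ l^-1).
by rewrite scalerA mulVf// scale1r invr_neq0// => /(_ isT).
Qed.

Lemma mulDsc x y k l :
  (x + sc k) * (y + sc l) = x * y + (l *: x + k *: y) + sc (k * l).
Proof.
by rewrite mulrDl !mulrDr !mulZr !mulZl mulr1 mul1r mulr1 scalerA mulrC !addrA.
Qed.

(** If z is in the spectrum of x, then z + it is in that of x + it, so |z +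
it|^2 is at most |x + it|^2 <= |x|^2 + t^2 by the C*-identity. The left side
grows by 2 t Im z more than t^2, which is impossible for all real t unless Im z
= 0. *)
Lemma spec_Im x k : selfadjoint x -> spectrum x k -> complex.Im k = 0.
Proof.
move=> hx xk.
have ineq t : complex.Re k ^+ 2 + (complex.Im k + t) ^+ 2 <= rn x ^+ 2 + t ^+ 2.
  have /spec_le h := spec_shift (l := Complex 0 t) xk.
  have := ler_pM (rn_ge0 _) (rn_ge0 _) h h; rewrite -!expr2 rn_sqrE.
  case: (k) => p q /=; rewrite addr0 => /le_trans; apply.
  rewrite -(rn_starM (x + _)) starD starZ star1 hx mulDsc -scalerDl.
  have -> : Complex 0 t + Num.conj (Complex 0 t) = 0.
    by apply/eqP; rewrite eq_complex/= addr0 subrr eqxx.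
  have -> : Num.conj (Complex 0 t) * Complex 0 t = (t ^+ 2)%:C.
    apply/eqP; rewrite eq_complex/= !(mul0r, mulr0, addr0, add0r) mulNr opprK.
    by rewrite expr2 !eqxx.
  rewrite scale0r addr0; apply: le_trans (rnD _ _) _.
  rewrite rn_sqr// lerD2l rnZ rnR ger0_norm ?sqr_ge0//.
  by rewrite ler_piMr ?sqr_ge0// rn1_le1.
apply/eqP; apply: contraT => q0.
(* For this t the cross term 2 t Im k exceeds the square of the norm by 1. *)
have := ineq ((rn x ^+ 2 + 1) / (2 * complex.Im k)).
set p := complex.Re k; set q := complex.Im k in q0 *; set N := rn x ^+ 2.
have -> : (q + (N + 1) / (2 * q)) ^+ 2 = q ^+ 2 + (N + 1) + ((N + 1) / (2 * q)) ^+ 2.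
  by field.
have := sqr_ge0 p; have := sqr_ge0 q; set r := (_ / _) ^+ 2; lra.
Qed.

Lemma spec_real x k : selfadjoint x -> spectrum x k -> k = (complex.Re k)%:C.
Proof. by move=> hx /(spec_Im hx); case: k => p q /= ->. Qed.

(** If w inverts k - y x, then (1 + x w y) / k inverts k - x y. *)
Lemma spec_swap x y k : k != 0 -> spectrum (x * y) k -> spectrum (y * x) k.
Proof.
move=> k0 xy [w [h1 h2]]; apply: xy.
have -> : sc k - x * y = k *: (1 - k^-1 *: (x * y)).
  by rewrite scalerBr scalerA mulfV// scale1r.
have e1 : k *: w - y * x * w = 1 by rewrite -h1 mulrBl mulZl mul1r.
have e2 : k *: w - w * (y * x) = 1 by rewrite -h2 mulrBr mulZr mulr1.
apply: cinvZ => //; exists (1 + x * w * y); split.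
- rewrite mulrDr mulr1 mulrBl mul1r mulZl.
  have -> : x * w * y - k^-1 *: (x * y * (x * w * y)) =
      k^-1 *: (x * (k *: w - y * x * w) * y).
    by rewrite mulrBr mulrBl scalerBr mulZr mulZl scalerA mulVf// scale1r !mulrA.
  by rewrite e1 mulr1 subrK.
- rewrite mulrDl mul1r mulrBr mulr1 mulZr.
  have -> : x * w * y - k^-1 *: (x * w * y * (x * y)) =
      k^-1 *: (x * (k *: w - w * (y * x)) * y).
    by rewrite mulrBr mulrBl scalerBr mulZr mulZl scalerA mulVf// scale1r !mulrA.
  by rewrite e2 mulr1 subrK.
Qed.

Lemma cinv_1Dsqr c : selfadjoint c -> cinvertible (1 + c * c).
Proof.
move=> hc.
have h (t : R) : t != 0 -> cinvertible (sc (Complex 0 t) - c).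
  by move=> t0; apply: contrapT => /(spec_Im hc)/= /eqP; rewrite (negbTE t0).
have := cinvM (cinvN (h 1 (oner_neq0 _))) (cinvN (h (-1) _)).
rewrite oppr_eq0 oner_eq0 => /(_ isT).
rewrite !opprB -!scaleNr mulDsc -scalerDl.
have -> : - (Complex 0 (-1)) + - Complex 0 1 = 0 :> R[i].
  by apply/eqP; rewrite eq_complex/= oppr0 addr0 opprK subrr !eqxx.
have -> : - Complex 0 1 * - Complex 0 (-1) = 1 :> R[i].
  apply/eqP; rewrite eq_complex/= oppr0 !(mul0r, mulr0, addr0, add0r) opprK.
  by rewrite mulr1 opprK !eqxx.
by rewrite scale0r addr0 scale1r addrC.
Qed.

(** With g = (1 + ic) v one has g^* g = v and g + g^* = 2 v, so that u = 1 - 2 g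
is unitary (it is a Cayley transform of c) and has norm at most 1; and 4 i c v =
u^* - u. *)
Lemma cayley c v : selfadjoint c -> (1 + c * c) * v = 1 -> v * (1 + c * c) = 1 ->
  c * v = v * c /\ rn (c * v) <= 2^-1.
Proof.
move=> hc h1 h2.
have cv : c * v = v * c.
  have e : (1 + c * c) * c = c * (1 + c * c) by rewrite mulrDl mulrDr mul1r mulr1 mulrA.
  by rewrite -[RHS]mulr1 -h1 -(mulrA v c) (mulrA c) -e -mulrA mulrA h2 mul1r.
split => //.
have hm : selfadjoint (1 + c * c) by apply: saD; [exact: sa1|exact: saM].
have hv : star v = v.
  by rewrite -[LHS]mulr1 -h1 mulrA -{1}hm -starMr h1 star1 mul1r.
have hcv : star (c * v) = c * v by rewrite starMr hv hc cv.
pose g := v + Complex 0 1 *: (c * v).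
have gs : star g = v - Complex 0 1 *: (c * v).
  rewrite /g starD hv starZ hcv -scaleNr; congr (_ + _ *: _).
  by apply/eqP; rewrite eq_complex/= oppr0 !eqxx.
have gsg : star g * g = v.
  rewrite gs /g mulrBl !mulrDr.
  rewrite !mulZl !mulZr scalerA.
  have -> : Complex 0 1 * Complex 0 1 = -1 :> R[i].
    by apply/eqP; rewrite eq_complex/= !(mul0r, mulr0, addr0, add0r) mulr1 oppr0 !eqxx.
  have -> : v * (c * v) = c * v * v by rewrite mulrA cv.
  rewrite scaleN1r opprD addrA addrK opprK.
  have -> : c * v * (c * v) = c * c * v * v 
    by rewrite -!mulrA; congr (_ * _); rewrite mulrA -cv mulrA.
  by rewrite -mulrDl -{1}(mul1r v) -mulrDl h1 mul1r.
have gD : g + star g = 2 *: v by rewrite gs /g addrACA subrr addr0 -mulr2n scaler_nat.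
pose u := 1 - 2 *: g.
have uu : star u * u = 1.
  rewrite /u starB star1 starZ.
  have -> : Num.conj (2 : R[i]) = 2 by rewrite -(rmorph_nat (real_complex R)) conjR.
  have e (w : A) : 1 - 2 *: w = - 2 *: w + sc 1 by rewrite scale1r scaleNr addrC.
  rewrite !e mulDsc mulZl mulZr gsg !scale1r mul1r scale1r -scalerDr.
  rewrite (addrC (star g)) gD !scalerA -scalerDl.
  have -> : - 2 * - 2 + - 2 * 2 = 0 :> R[i] by ring.
  by rewrite scale0r add0r.
have un : rn u <= 1.
  have := rn_starM u; rewrite uu; have := @rn1_le1 R A; have := rn_ge0 u.
  by move: (rn u) (rn (1 : A)) => p q; nra.
have ue : (4 * Complex 0 1) *: (c * v) = star u - u.
  rewrite /u starB star1 starZ.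
  have -> : Num.conj (2 : R[i]) = 2 by rewrite -(rmorph_nat (real_complex R)) conjR.
  rewrite opprB addrC addrA subrK -scalerBr gs /g opprB addrC addrA subrK.
  by rewrite scalerDr !scalerA -scalerDl; congr (_ *: _); ring.
have : rn ((4 * Complex 0 1) *: (c * v)) <= 2.
  rewrite ue; apply: le_trans (rnD _ _) _; rewrite rnN rn_star.
  by move: un; move: (rn u) => p; lra.
rewrite rnZ rnCM.
have -> : rn (Complex 0 1 : R[i]) = 1.
  by rewrite /rn normc_def/= expr0n/= add0r expr1n sqrtr1.
have -> : rn (4 : R[i]) = 4 by rewrite -(rmorph_nat (real_complex R)) rnR ger0_norm.
by rewrite mulr1; move: (rn _) => p; lra.
Qed.

Lemma mulr_swap_mid x y z : x * y = y * x -> x * x * (y * z) = x * y * (x * z).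
Proof. by move=> h; rewrite -!mulrA (mulrA y x) -h -mulrA. Qed.

(** This replaces the spectral radius formula. Let s_k = a^(2^k), of norm 1, and
suppose 1 - s_1 is invertible. Then every 1 - s_k is, because 1 - s^2 = (1 - s)
(1 + s) and 1 + c^2 is always invertible. The elements d_k = s_k / (1 - s_k)
satisfy d_(k+1) = d_k s_k / (1 + s_k), and the last factor has norm at most 1/2
by [cayley]. So d_k tends to 0, and with it s_k = d_k (1 - s_k), contradicting
|s_k| = 1. *)
Lemma no_inv_1Bsqr a : selfadjoint a -> rn a = 1 -> ~ cinvertible (1 - a * a).
Proof.
move=> ha a1 [r0 [r01 r02]].
pose s := fix s n := if n is n'.+1 then s n' * s n' else a.
have sS n : s n.+1 = s n * s n by [].
have ss n : selfadjoint (s n) by elim: n => // n IH; rewrite sS; apply: saM.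
have s1 n : rn (s n) = 1 by elim: n => // n IH; rewrite sS rn_sqr// IH expr1n.
pose C := rn (s 1%N * r0).
have main n : exists r, [/\ (1 - s n.+1) * r = 1, r * (1 - s n.+1) = 1
    & rn (s n.+1 * r) <= C * 2^-1 ^+ n].
  elim: n => [|n [r [h1 h2 h3]]]; first by exists r0; rewrite expr0 mulr1.
  have [v [v1 v2]] := cinv_1Dsqr (ss n).
  have [cv bd] := cayley (ss n) v1 v2.
  rewrite -sS in v1 v2.
  set S := s n.+1 in h1 h2 h3 v1 v2.
  rewrite (sS n.+1) -/S; have SE : S = s n * s n := sS n; clearbody S.
  have Sv : S * v = v * S by rewrite SE -mulrA cv mulrA cv mulrA.
  exists (v * r); split.
  - have -> : 1 - S * S = (1 - S) * (1 + S).
      by rewrite mulrBl mul1r mulrDr mulr1 opprD addrA addrK.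
    by rewrite -mulrA (mulrA (1 + S)) v1 mul1r h1.
  - have -> : 1 - S * S = (1 - S) * (1 + S).
      by rewrite mulrBl mul1r mulrDr mulr1 opprD addrA addrK.
    by rewrite -mulrA (mulrA r) h2 mul1r.
  - have -> : S * S * (v * r) = (S * v) * (S * r)  by apply: mulr_swap_mid.
    rewrite exprS mulrCA; apply: le_trans (rnM _ _) _.
    apply: ler_pM; rewrite ?rn_ge0//.
    rewrite SE -mulrA; apply: le_trans (rnM _ _) _.
    by rewrite s1 mul1r.
have q01 : 0 <= (2^-1 : R) < 1 by apply/andP; split; lra.
have [n hn] := geo_small (2 * C) q01 ltr01.
have [r [h1 h2 h3]] := main n.
have := s1 n.+1; rewrite -[s n.+1]mulr1 -h2 mulrA => h4.
have := rnM (s n.+1 * r) (1 - s n.+1); rewrite h4.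
have h5 : rn (1 - s n.+1) <= 2.
  by apply: le_trans (rnD _ _) _; rewrite rnN s1 -[2]/(1 + 1) lerD2r rn1_le1.
have := rn_ge0 (1 - s n.+1); have := rn_ge0 (s n.+1 * r).
move: hn h3 h5; rewrite -mulrA; set p := rn _; set q := rn _; set u := C * _.
nra.
Qed.

Lemma spec_norm a : selfadjoint a -> a != 0 ->
  spectrum a (rn a)%:C \/ spectrum a (- rn a)%:C.
Proof.
move=> ha a0.
have N0 : rn a != 0 by apply: contraNneq a0 => /rn_eq0 ->.
have N0' : (rn a)%:C != 0 :> R[i] by rewrite -(inj_eq (@complexI R)) in N0.
pose b := ((rn a)^-1)%:C *: a.
have hb : selfadjoint b by apply: saZ.
have b1 : rn b = 1 by rewrite /b rnZ rnR ger0_norm ?invr_ge0 ?rn_ge0// mulVf.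
have bE : a = (rn a)%:C *: b by rewrite scalerA -rmorphM/= mulfV// scale1r.
have : spectrum b 1 \/ spectrum b (-1).
  apply: contrapT => /not_orP[/contrapT h1 /contrapT h2].
  apply: (no_inv_1Bsqr hb b1).
  have := cinvM h1 (cinvN h2).
  rewrite scaleN1r scale1r opprB opprK (addrC b) mulrBl mul1r mulrDr mulr1.
  by rewrite opprD addrA addrK; apply.
rewrite rmorphN/= => -[|] h; [left|right].
  by have := specZ N0' h; rewrite -bE mulr1.
by have := specZ N0' h; rewrite -bE mulrN1.
Qed.

Lemma rn_le_spec a t : selfadjoint a -> 0 <= t ->
  (forall s, spectrum a s%:C -> `|s| <= t) -> rn a <= t.
Proof.
move=> ha t0 h; have [->|a0] := eqVneq a 0; first by rewrite rn0.
by have [/h|/h] := spec_norm ha a0; rewrite ?normrN ger0_norm ?rn_ge0.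
Qed.

Lemma spec_inP x (I : set R) : selfadjoint x ->
  spectrum_in x I <-> (forall t, spectrum x t%:C -> I t).
Proof.
move=> hx; split=> [h t /h[s Is /complexI <-]//|h k xk].
exists (complex.Re k); last by rewrite -(spec_real hx xk).
by apply: h; rewrite -(spec_real hx xk).
Qed.

Lemma cpos_sa h : cpos h -> selfadjoint h. Proof. by case. Qed.

Lemma cpos_spec h t : cpos h -> spectrum h t%:C -> 0 <= t.
Proof. by move=> [hs /(spec_inP _ hs)]; apply. Qed.

Lemma cpos_rnB h t : cpos h -> rn h <= t -> rn (sc t%:C - h) <= t.
Proof.
move=> hp ht; apply: rn_le_spec.
- by apply: saB (cpos_sa hp); apply: saC.
- by apply: le_trans ht; apply: rn_ge0.
move=> s /spec_sub; rewrite -rmorphB/= => hs.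
have := cpos_spec hp hs; have := spec_le hs; rewrite rnR => /le_trans/(_ ht).
move=> h1 h2; move: h1; rewrite ger0_norm// => h1.
have s0 : 0 <= s by lra.
by rewrite ger0_norm; lra.
Qed.

(** Together with [cpos_rnB] this describes positivity by the norm: the spectrum
of h lies in the disc of radius t around t. The norm condition is visibly stable
under sums, which the condition on spectra is not. *)
Lemma cposP_rnB h t : selfadjoint h -> rn (sc t%:C - h) <= t -> cpos h.
Proof.
move=> hs ht; split => //; apply/spec_inP => // s /= hsp.
have : spectrum (sc t%:C - h) (t - s)%:C.
  by apply/spec_sub; rewrite -rmorphB/= opprB addrC subrK.
by move/spec_le; rewrite rnR => /le_trans/(_ ht); rewrite ler_norml; lra.
Qed.

Lemma cposD x y : cpos x -> cpos y -> cpos (x + y).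
Proof.
move=> hx hy; apply: (@cposP_rnB _ (rn x + rn y)).
  by apply: saD; apply: cpos_sa.
rewrite rmorphD/= scalerDl opprD addrACA; apply: le_trans (rnD _ _) _.
by apply: lerD; apply: cpos_rnB.
Qed.

Lemma cposC t : 0 <= t -> cpos (sc t%:C).
Proof.
move=> t0; apply: (@cposP_rnB _ t); first exact: saC.
by rewrite subrr rn0.
Qed.

Lemma cpos0 : cpos (0 : A).
Proof. by rewrite -(scale0r (1 : A)) -[0]/((0:R)%:C); apply: cposC. Qed.

Lemma cposZ t x : 0 <= t -> cpos x -> cpos (t%:C *: x).
Proof.
move=> t0 hx; apply: (@cposP_rnB _ (t * rn x)); first by apply/saZ/cpos_sa.
by rewrite rmorphM/= -scalerA -scalerBr rnZ rnR ger0_norm// ler_wpM2l// cpos_rnB.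
Qed.

Lemma cpos_sum (J : Type) (r : seq J) (P : pred J) (F : J -> A) :
  (forall j, P j -> cpos (F j)) -> cpos (\sum_(j <- r | P j) F j).
Proof. by move=> h; elim/big_ind: _ => //; [exact: cpos0|exact: cposD]. Qed.

(** For t < 0, h^2 - t = -t (1 + (h/r)^2) with r^2 = -t, which is invertible. *)
Lemma cpos_sqr h : selfadjoint h -> cpos (h * h).
Proof.
move=> hs; split; first exact: saM.
apply/spec_inP; first exact: saM.
move=> t /= ht; rewrite leNgt; apply/negP => t0; apply: ht.
pose r := Num.sqrt (- t).
have rr : r ^+ 2 = - t by rewrite sqr_sqrtr// oppr_ge0 ltW.
have r0 : r != 0.
  apply/eqP => r0; move: rr; rewrite r0 expr0n/= => /eqP.
  by rewrite eq_sym oppr_eq0 lt_eqF.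
have tE : t%:C != 0 :> R[i].
  by apply/eqP => /complexI tE; move: t0; rewrite tE ltxx.
have -> : sc t%:C - h * h = t%:C *: (1 + (r^-1%:C *: h) * (r^-1%:C *: h)).
  rewrite mulZl mulZr scalerA scalerDr scalerA -!rmorphM/= -(expr2 r^-1) exprVn rr.
  by rewrite invrN mulrN mulfV ?lt_eqF// rmorphN1 scaleN1r.
by apply: cinvZ => //; apply/cinv_1Dsqr/saZ.
Qed.

Lemma cpos_anti h : cpos h -> cpos (- h) -> h = 0.
Proof.
move=> h1 h2; apply: rn_eq0; apply/le_anti; rewrite rn_ge0 andbT.
apply: rn_le_spec => // [|s hs]; first exact: cpos_sa.
have s0 := cpos_spec h1 hs.
have : spectrum (- h) (- s)%:C.
  rewrite -[- h]add0r -(scale0r (1 : A)); apply/spec_sub.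
  by rewrite sub0r rmorphN/= opprK.
move/(cpos_spec h2); rewrite oppr_ge0 => s1.
by rewrite ger0_norm.
Qed.

Lemma cpos_rn_sub h t : selfadjoint h -> rn h <= t -> cpos (sc t%:C - h).
Proof.
move=> hs ht; apply: (@cposP_rnB _ t); first by apply: saB => //; apply: saC.
by rewrite opprB addrC subrK.
Qed.

End Spectrum2.

(** * Polynomials in a selfadjoint element *)

Section PolyCalculus.
Context {R : realType} {A : cstarAlgType R}.
Implicit Types (x y z h : A) (k l : R[i]) (t s : R) (p q : {poly R[i]}).

Local Notation sc k := (k *: (1 : A)).

(** Evaluation of p at x, as an explicit sum because the algebra may be the zero
ring. *)
Definition pev x p : A := \sum_(i < size p) p`_i *: x ^+ i.

Lemma pevE x p n : (size p <= n)%N -> pev x p = \sum_(i < n) p`_i *: x ^+ i.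
Proof.
move=> pn; rewrite /pev (big_ord_widen n (fun i => p`_i *: x ^+ i) pn) big_mkcond/=.
apply: eq_bigr => i _; case: ltnP => // h.
by rewrite nth_default// scale0r.
Qed.

Lemma pevD x p q : pev x (p + q) = pev x p + pev x q.
Proof.
pose n := maxn (size p) (size q).
rewrite (@pevE x p n) ?leq_maxl// (@pevE x q n) ?leq_maxr//.
rewrite (@pevE x _ n) ?size_polyD// -big_split/=.
by apply: eq_bigr => i _; rewrite coefD scalerDl.
Qed.

Lemma pevZ x k p : pev x (k *: p) = k *: pev x p.
Proof.
rewrite (@pevE x _ (size p)) ?size_scale_leq// /pev scaler_sumr.
by apply: eq_bigr => i _; rewrite coefZ scalerA.
Qed.

Lemma pevB x p q : pev x (p - q) = pev x p - pev x q.
Proof. by rewrite pevD -scaleN1r pevZ scaleN1r. Qed.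

Lemma pevXM x p : pev x ('X * p) = x * pev x p.
Proof.
have sz : (size (('X : {poly R[i]}) * p)%R <= (size p).+1)%N.
  by rewrite mulrC; case: (eqVneq p 0) => [->|p0]; rewrite ?mul0r ?size_poly0// size_mulX.
rewrite (pevE _ sz) big_ord_recl/= coefXM/= scale0r add0r /pev mulr_sumr.
by apply: eq_bigr => i _; rewrite coefXM/= mulZr exprS.
Qed.

Lemma pevC x k : pev x k%:P = sc k.
Proof. by rewrite (@pevE x _ 1) ?size_polyC_leq1// big_ord1 coefC/= expr0. Qed.

Lemma pev0 x : pev x 0 = 0.
Proof. by rewrite -[0]/(0%:P) pevC scale0r. Qed.

Lemma pevM x p q : pev x (p * q) = pev x p * pev x q.
Proof.
elim/poly_ind: p => [|p k IH].
  by rewrite mul0r pev0 mul0r.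
have -> : (p * 'X + k%:P) * q = 'X * (p * q) + k *: q by rewrite -mul_polyC; ring.
by rewrite !pevD (mulrC p 'X) !pevXM IH pevZ pevC mulrDl mulrA mulZl mul1r.
Qed.

Lemma pevX x : pev x 'X = x.
Proof. by rewrite -['X]mulr1 pevXM -[1]/(1%:P) pevC scale1r mulr1. Qed.

Lemma pev_comm x p q : pev x p * pev x q = pev x q * pev x p.
Proof. by rewrite -!pevM mulrC. Qed.

Lemma pev_commX x p : pev x p * x = x * pev x p.
Proof. by have := pev_comm x p 'X; rewrite pevX. Qed.

Lemma star_pev x p : selfadjoint x -> star (pev x p) = pev x (map_poly Num.conj p).
Proof.
move=> hx; elim/poly_ind: p => [|p k IH].
  by rewrite rmorph0 pev0 star0.
rewrite rmorphD rmorphM/= map_polyX map_polyC/= !pevD starD !pevC starZ star1.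
by rewrite (mulrC p) (mulrC (map_poly _ p)) !pevXM starMr IH hx pev_commX.
Qed.

(** Over the algebraically closed field R[i] the polynomial p - k splits into
linear factors, and p(x) - k can fail to be invertible only if one of the
factors x - l does. *)
Lemma spec_pev x p k : selfadjoint x -> spectrum (pev x p) k ->
  exists2 l, spectrum x l & k = p.[l].
Proof.
move=> hx; rewrite /spectrum/= => nk.
pose q := p - k%:P.
have nq : ~ cinvertible (pev x q).
  move=> h; apply: nk; rewrite -opprB; apply: cinvN.
  by move: h; rewrite /q pevB pevC.
have [q0|q0] := eqVneq q 0.
  have [l xl] : exists l, spectrum x l.
    have [x0|x0] := eqVneq x 0; last first.
      by have [h|h] := spec_norm hx x0; [exists (rn x)%:C|exists (- rn x)%:C].
    exists 0; rewrite /spectrum/= x0 scale0r subr0.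
    by move: nq; rewrite q0 pev0.
  exists l => //; have : q.[l] = 0 by rewrite q0 horner0.
  by rewrite /q hornerD hornerN hornerC => /eqP; rewrite subr_eq0 => /eqP.
have [r rE] := closed_field_poly_normal q.
have lc : lead_coef q != 0 by rewrite lead_coef_eq0.
have [l lr xl] : exists2 l, l \in r & spectrum x l.
  apply: contrapT => hr; apply: nq; rewrite rE pevZ; apply: cinvZ => //.
  have {}hr l : l \in r -> cinvertible (sc l - x).
    by move=> lr; apply: contrapT => h; apply: hr; exists l.
  elim: r hr {rE} => [|l r IH] hr.
    rewrite big_nil -[1]/(1%:P) pevC scale1r.
    by exists 1; rewrite mulr1.
  rewrite big_cons pevM; apply: cinvM.
    rewrite pevB pevC pevX -opprB; apply/cinvN/hr.
    by rewrite mem_head.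
  by apply: IH => m mr; apply: hr; rewrite in_cons mr orbT.
exists l => //; have : root q l.
  by rewrite rE rootZ// root_prod_XsubC.
by rewrite /root /q hornerD hornerN hornerC subr_eq0 => /eqP.
Qed.

(** By the C*-identity it suffices to bound the selfadjoint element star(p(x))
p(x), which is a polynomial in x again and whose norm is read off its spectrum.
*)
Lemma rn_pev_le x p t : selfadjoint x -> 0 <= t ->
  (forall s, spectrum x s%:C -> rn p.[s%:C] <= t) -> rn (pev x p) <= t.
Proof.
move=> hx t0 h.
suff : rn (star (pev x p) * pev x p) <= t ^+ 2.
  by rewrite rn_starM ler_sqr ?nnegrE ?rn_ge0.
apply: rn_le_spec; [exact: sa_star|exact: sqr_ge0|move=> s].
rewrite star_pev// -pevM => /(spec_pev hx)[l xl] e.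
have lE := spec_real hx xl; rewrite -rnR e hornerM rnCM expr2.
have -> : (map_poly Num.conj p).[l] = Num.conj p.[l].
  by rewrite -horner_map/= {2}lE conjR -lE.
by rewrite rnJ; apply: ler_pM; rewrite ?rn_ge0// lE; apply: h; rewrite -lE.
Qed.

End PolyCalculus.

(** * Bernstein polynomials *)

Section Bernstein.
Context {R : realType}.
Implicit Types (q : {poly R[i]}) (phi : nat -> R[i]).

(** Bernstein polynomials with nodes phi, in the variable q, by the recursion of
repeated coin tosses instead of binomial coefficients: the law of large numbers
then needs only [bern_avg_var]. *)
Fixpoint bern q n phi : {poly R[i]} :=
  if n is m.+1 then q * bern q m (fun i => phi i.+1) + (1 - q) * bern q m phi
  else (phi 0%N)%:P.

(** The expectation of phi under the binomial distribution with parameters n and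
s. *)
Fixpoint bern_avg (s : R) n (phi : nat -> R) : R :=
  if n is m.+1 then s * bern_avg s m (fun i => phi i.+1) + (1 - s) * bern_avg s m phi
  else phi 0%N.

Lemma bern_avg_le (s : R) n (phi psi : nat -> R) : 0 <= s <= 1 ->
  (forall i, (i <= n)%N -> phi i <= psi i) -> bern_avg s n phi <= bern_avg s n psi.
Proof.
move=> /andP[s0 s1]; elim: n phi psi => [|n IH] phi psi h /=; first exact: h.
apply: lerD; apply: ler_wpM2l; rewrite ?subr_ge0//; apply: IH => i ni; apply: h.
- by [].
- exact: leqW.
Qed.

Lemma bern_avg_affine (s : R) n (a b : R) (phi : nat -> R) :
  bern_avg s n (fun i => a + b * phi i) = a + b * bern_avg s n phi.
Proof. by elim: n phi => [|n IH] phi //=; rewrite !IH; ring. Qed.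

Lemma bern_avg_var (s : R) n (c : R) :
  bern_avg s n (fun i => (i%:R - c) ^+ 2) = n%:R * s * (1 - s) + (n%:R * s - c) ^+ 2.
Proof.
elim: n c => [|n IH] c; first by rewrite /=; ring.
rewrite /= IH -natr1.
have -> : bern_avg s n (fun i => (i.+1%:R - c) ^+ 2) =
    bern_avg s n (fun i => (i%:R - (c - 1)) ^+ 2).
  congr bern_avg; apply/funext => i; rewrite -natr1; congr (_ ^+ 2); ring.
by rewrite IH; ring.
Qed.

Lemma bern_horner q (k : R[i]) (s : R) n phi l : 0 <= s <= 1 -> q.[k] = s%:C ->
  rn ((bern q n phi).[k] - l) <= bern_avg s n (fun i => rn (phi i - l)).
Proof.
move=> s01 qk; elim: n phi => [|n IH] phi /=; first by rewrite hornerC.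
case/andP: (s01) => s0 s1.
rewrite !hornerE qk.
set u := (bern _ _ _).[k]; set v := (bern _ _ _).[k].
have -> : s%:C * u + (1 - s%:C) * v - l = s%:C * (u - l) + (1 - s)%:C * (v - l).
  by rewrite rmorphB rmorph1; ring.
apply: le_trans (rnD _ _) _; rewrite !rnCM !rnR !ger0_norm ?subr_ge0//.
by apply: lerD; apply: ler_wpM2l; rewrite ?subr_ge0// IH.
Qed.

End Bernstein.

(** * Uniform estimates on compact sets of reals *)

Section CompactUniformity.
Context {R : realType}.
Implicit Types (K : set R) (s t u e d C : R).

(** A finite subcover argument, in the form of a filter on finite lists of
labels generated by list inclusion. *)
Lemma compact_finite_choice (T : eqType) K (Q : T -> R -> Prop) : compact K ->
  (forall u, K u -> exists d l, 0 < d /\ forall s, K s -> `|s - u| < d -> Q l s) ->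
  exists L : seq T, forall s, K s -> exists2 l, l \in L & Q l s.
Proof.
move=> /compact_near_coveringP/near_covering_withinP cK hQ.
pose F : set_system (seq T) :=
  [set S | exists L0 : seq T, forall L : seq T, {subset L0 <= L} -> S L].
have FF : Filter F.
  split; first by exists [::].
    move=> S1 S2 [L1 h1] [L2 h2]; exists (L1 ++ L2) => L hL; split.
      by apply: h1 => l lL; apply: hL; rewrite mem_cat lL.
    by apply: h2 => l lL; apply: hL; rewrite mem_cat lL orbT.
  by move=> S1 S2 S12 [L1 h1]; exists L1 => L /h1; apply: S12.
have [|L0 hL0] := cK _ F (fun L s => exists2 l, l \in L & Q l s) FF.
  move=> u Ku; have [d [l [d0 hl]]] := hQ u Ku.
  exists (ball u d, [set L : seq T | l \in L]) => /=.
    split; first exact: nbhsx_ballx.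
    by exists [:: l] => L; apply; rewrite mem_head.
  move=> [s L] /= [us lL] Ks; exists l => //; apply: hl => //.
  by rewrite distrC.
by exists L0; exact: hL0.
Qed.

Lemma compact_uniform K (P : R -> R -> Prop) : compact K ->
  (forall C C' s, C <= C' -> P C s -> P C' s) ->
  (forall u, K u -> exists d C, 0 < d /\ forall s, K s -> `|s - u| < d -> P C s) ->
  exists2 C, 0 <= C & forall s, K s -> P C s.
Proof.
move=> cK mono /(compact_finite_choice cK)[L hL].
exists (\big[Num.max/0]_(l <- L) l); first exact: bigmax_ge_id.
move=> s /hL[l lL]; apply: mono; exact: le_bigmax_seq.
Qed.

(** Continuity relative to K in terms of real radii. It lets functions on the
spectrum, which live on R[i], be handled as functions of a real variable. *)
Definition econt K (V : normedZmodType R[i]) (G : R -> V) := forall t, K t ->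
  forall e, 0 < e -> exists2 d, 0 < d &
    forall s, K s -> `|s - t| < d -> rn (G s - G t) < e.

Variables (V : normedZmodType R[i]) (G : R -> V) (K : set R).
Hypotheses (cK : compact K) (cG : econt K G).

Lemma econt_bounded : exists2 B, 0 <= B & forall s, K s -> rn (G s) <= B.
Proof.
apply: compact_uniform => // [C C' s CC' /le_trans|]; first exact.
move=> u Ku; have [d d0 h] := cG Ku ltr01; exists d, (1 + rn (G u)); split => // s Ks su.
rewrite -[G s](subrK (G u)); apply: le_trans (rnD _ _) _.
by rewrite lerD2r; apply/ltW/h.
Qed.

(** Uniform continuity and boundedness in one estimate: nearby points give the
term e, distant ones are absorbed by the quadratic term. This is the form in
which the variance of Bernstein averages controls the error of approximation. *)
Lemma econt_quadratic e : 0 < e ->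
  exists2 C, 0 <= C & forall s t, K s -> K t -> rn (G s - G t) <= e + C * (s - t) ^+ 2.
Proof.
move=> e0; have [B B0 hB] := econt_bounded.
have [||C C0 h] := @compact_uniform K
  (fun C s => forall t, K t -> rn (G s - G t) <= e + C * (s - t) ^+ 2) cK.
- move=> C C' s CC' h t Kt; apply: le_trans (h t Kt) _.
  by rewrite lerD2l ler_wpM2r// sqr_ge0.
- move=> u Ku; have e20 : 0 < e / 2 by rewrite divr_gt0.
  have [d d0 h] := cG Ku e20.
  exists (d / 2), (8 * B / d ^+ 2); split; first by rewrite divr_gt0.
  have P0 : 0 <= 8 * B / d ^+ 2.
    by apply: divr_ge0 (sqr_ge0 _); apply: mulr_ge0 B0; apply: ler0n.
  move=> s Ks su t Kt; have [tu|tu] := ltP `|t - u| d.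
    have -> : G s - G t = (G s - G u) - (G t - G u) by rewrite opprB addrA subrK.
    apply: le_trans (rnD _ _) _; rewrite rnN.
    have sd : `|s - u| < d by apply: lt_trans su _; rewrite ltr_pdivrMr// ltr_pMr// ltr1n.
    have := h _ Ks sd; have := h _ Kt tu.
    have : 0 <= 8 * B / d ^+ 2 * (s - t) ^+ 2.
      by rewrite mulr_ge0 ?sqr_ge0.
    move: (8 * B / _ * _) (rn (G s - _)) (rn (G t - _)) => p q r; lra.
  apply: (@le_trans _ _ (2 * B)).
    apply: le_trans (rnD _ _) _; rewrite rnN.
    by have := hB _ Ks; have := hB _ Kt; lra.
  apply: ler_wpDl; first exact: ltW.
  have st : (d / 2) ^+ 2 <= (s - t) ^+ 2.
    rewrite -[leRHS]real_normK ?num_real// ler_sqr ?nnegrE ?divr_ge0 ?(ltW d0)//.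
    have := ler_distD s u t; rewrite (distrC u t) (distrC u s); lra.
  apply: (@le_trans _ _ (8 * B / d ^+ 2 * (d / 2) ^+ 2)).
    by rewrite le_eqVlt; apply/orP; left; apply/eqP; field; rewrite gt_eqF.
  by apply: ler_wpM2l.
by exists C => // s t Ks Kt; apply: h.
Qed.

End CompactUniformity.

(** * Weierstrass approximation on the spectrum *)

Section SpectrumTopology.
Context {R : realType} {A : cstarAlgType R}.
Implicit Types (x y z h : A) (k l : R[i]) (t s e : R) (p q : {poly R[i]}).
Implicit Types (g : R[i] -> R[i]).

Local Notation sc k := (k *: (1 : A)).

Definition rspec x : set R := [set t | spectrum x t%:C].

Lemma rspec_closed x : closed (rspec x).
Proof.
rewrite -[rspec x]setCK; apply: open_closedC; rewrite openE => t /=.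
rewrite /rspec/= /spectrum/= => /contrapT[w [h1 h2]].
have w0 : 0 < rn w + 1 by rewrite ltr_wpDl ?rn_ge0.
apply/nbhs_ballP; exists (rn w + 1)^-1 => /=; first by rewrite invr_gt0.
move=> s /= ts; apply.
have -> : sc s%:C - x = (sc t%:C - x) * (1 - (t - s)%:C *: w).
  by rewrite mulrBr mulr1 mulZr h1 rmorphB/= scalerBl opprB [RHS]addrC addrA subrK.
apply: cinvM; first by exists w.
apply: neumann; rewrite rnZ rnR.
apply: (@le_lt_trans _ _ (`|t - s| * (rn w + 1))).
  by apply: ler_wpM2l => //; rewrite lerDl.
by rewrite -ltr_pdivlMr// mul1r.
Qed.

Lemma rspec_bound x t : rspec x t -> `|t| <= rn x.
Proof. by move=> /spec_le; rewrite rnR. Qed.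

Lemma rspec_compact x : compact (rspec x).
Proof.
apply: (@subclosed_compact _ _ `[(- rn x), (rn x)]).
- exact: rspec_closed.
- exact: segment_compact.
- by move=> t /rspec_bound; rewrite /= in_itv/= ler_norml.
Qed.

Lemma spec_contP x g : selfadjoint x ->
  spectrum_continuous x g <-> econt (rspec x) (fun t => g t%:C).
Proof.
move=> hx; rewrite /spectrum_continuous; split.
- move=> /subspace_continuousP cg t xt e e0.
  have /cvgrPdist_lt/(_ e%:C) := cg _ xt.
  rewrite ltcR => /(_ e0) /nbhs_ballP[d /= d0 hd].
  have dE : d = (complex.Re d)%:C by rewrite RRe_real// gtr0_real.
  exists (complex.Re d); first by rewrite -ltcR -dE.
  move=> s xs st; have := hd s%:C.
  rewrite -ball_normE/= -rmorphB/= rnE rnR {1}dE ltcR distrC => /(_ st xs).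
  by rewrite rnE ltcR rn_distC.
- move=> cg; apply/subspace_continuousP => k xk.
  have kE := spec_real hx xk.
  apply/cvgrPdist_lt => e e0.
  have eE : e = (complex.Re e)%:C by rewrite RRe_real// gtr0_real.
  have e0' : 0 < complex.Re e by rewrite -ltcR -eE.
  have xk' : rspec x (complex.Re k) by rewrite /rspec/= -kE.
  have [d d0 hd] := cg _ xk' _ e0'.
  apply/nbhs_ballP; exists d%:C => /=; first by rewrite ltcR.
  move=> l; rewrite -ball_normE/= => kl xl.
  have lE := spec_real hx xl.
  have xl' : rspec x (complex.Re l) by rewrite /rspec/= -lE.
  change (`|g k - g l| < e); rewrite eE rnE ltcR rn_distC.
  have := hd _ xl'; rewrite -lE -kE; apply.
  by move: kl; rewrite rnE ltcR kE lE -rmorphB/= rnR distrC.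
Qed.

Lemma nearest_point (K : set R) c : compact K -> K !=set0 ->
  exists2 s, K s & forall t, K t -> `|s - c| <= `|t - c|.
Proof.
move=> cK K0.
have [|s Ks hs] := @compact_EVT_min _ R (fun t => `|t - c|) K K0 cK.
  apply: continuous_subspaceT => t.
  by apply: cvg_norm; apply: cvgB; [exact: cvg_id|exact: cvg_cst].
exists s; first by rewrite inE in Ks.
by move=> t Kt; apply: hs; rewrite inE.
Qed.

(** The Bernstein nodes need not lie in the spectrum, where alone g is
continuous; each node c_i is replaced by a nearest point of the spectrum. For t
in the spectrum this at most doubles the distance from t to the node, and it
does the work of a continuous extension of g. *)
Lemma spec_weierstrass x g e : selfadjoint x -> spectrum_continuous x g -> 0 < e ->
  exists p, forall t, rspec x t -> rn (p.[t%:C] - g t%:C) <= e.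
Proof.
move=> hx /(spec_contP _ hx) cg e0.
have [K0|/set0P K0] := eqVneq (rspec x) set0.
  by exists 0 => t; rewrite K0.
have cK : compact (rspec x) by exact: rspec_compact.
pose N := rn x + 1; have N0 : 0 < N by rewrite ltr_wpDl ?rn_ge0.
have e20 : 0 < e / 2 by rewrite divr_gt0.
have [C C0 hC] := econt_quadratic cK cg e20.
(* The variance of the mean of n tosses is at most 1/n, and the nodes are spread
over an interval of length 2 N; the constant comes from the factor 4 of the
doubled distances. *)
have [n hn] : exists n : nat, 32 * C * N ^+ 2 / e < n.+1%:R.
  exists (Num.truncn (32 * C * N ^+ 2 / e)).
  have /truncn_itv/andP[] // : 0 <= 32 * C * N ^+ 2 / e.
  apply: divr_ge0 (ltW e0); apply: mulr_ge0 (sqr_ge0 _).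
  by apply: mulr_ge0 C0; apply: ler0n.
pose c i : R := 2 * N * (i%:R / n.+1%:R) - N.
have [i|nd hnd] := @choice _ _ (fun (i : nat) s =>
    rspec x s /\ forall t, rspec x t -> `|s - c i| <= `|t - c i|).
  by have [s] := nearest_point (c i) cK K0; exists s.
pose q : {poly R[i]} := ((2 * N)^-1)%:C *: ('X + (N%:C)%:P).
exists (bern q n.+1 (fun i => g (nd i)%:C)) => t xt.
have tN : `|t| < N by apply: le_lt_trans (rspec_bound xt) _; rewrite ltrDl.
pose s := (2 * N)^-1 * (t + N).
have N20 : 0 < 2 * N by rewrite mulr_gt0.
have s01 : 0 <= s <= 1.
  move: tN; rewrite ltr_norml => /andP[h1 h2].
  rewrite /s mulr_ge0 ?invr_ge0 ?(ltW N20)//=; last by lra.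
  by rewrite mulrC ler_pdivrMr// mul1r; lra.
have qt : q.[t%:C] = s%:C.
  by rewrite /q /s hornerZ hornerD hornerX hornerC -rmorphD -rmorphM.
apply: le_trans (bern_horner n.+1 _ _ s01 qt) _.
have n0 : 0 < n.+1%:R :> R by rewrite ltr0n.
pose D := 4 * C * (2 * N / n.+1%:R) ^+ 2.
apply: (@le_trans _ _ (bern_avg s n.+1 (fun i => e / 2 + D * (i%:R - n.+1%:R * s) ^+ 2))).
  apply: bern_avg_le => // i _; have [xi hi] := hnd i.
  apply: le_trans (hC _ _ xi xt) _; rewrite lerD2l.
  have -> : D * (i%:R - n.+1%:R * s) ^+ 2 = C * (2 * (c i - t)) ^+ 2.
    rewrite /D /c /s; field; rewrite ?gt_eqF//.
  apply: ler_wpM2l => //.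
  rewrite -[leLHS]real_normK ?num_real// -[leRHS]real_normK ?num_real//.
  rewrite ler_sqr ?nnegrE// normrM (ger0_norm (ler0n R 2)).
  have := hi _ xt; have := ler_distD (c i) (nd i) t; rewrite (distrC (c i) t); lra.
rewrite bern_avg_affine bern_avg_var subrr expr0n/= addr0.
suff : D * (n.+1%:R * s * (1 - s)) <= e / 2 by lra.
have -> : D * (n.+1%:R * s * (1 - s)) = 16 * C * N ^+ 2 / n.+1%:R * (s * (1 - s)).
  by rewrite /D; field; rewrite gt_eqF.
have h1 : 16 * C * N ^+ 2 / n.+1%:R <= e / 2.
  rewrite ler_pdivrMr//; move: hn; rewrite ltr_pdivrMr//; lra.
have h0 : 0 <= 16 * C * N ^+ 2 / n.+1%:R.
  apply: divr_ge0 (ltW n0); apply: mulr_ge0 (sqr_ge0 _).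
  by apply: mulr_ge0 C0; apply: ler0n.
apply: le_trans h1; rewrite ler_piMr//.
by case/andP: s01; nra.
Qed.

End SpectrumTopology.

(** * The continuous functional calculus *)

Section FunctionalCalculus.
Context {R : realType} {A : cstarAlgType R}.
Implicit Types (x y z : A) (k l : R[i]) (t s e : R) (p q : {poly R[i]}).
Implicit Types (g h : R[i] -> R[i]).

(** y is the limit of p(x) along polynomials p that converge to g uniformly on
the spectrum of x. *)
Definition poly_limit x g y : Prop := forall e, 0 < e -> exists2 p,
  (forall t, rspec x t -> rn (p.[t%:C] - g t%:C) <= e) & rn (pev x p - y) <= e.

Lemma poly_limit_uniq x g h y z : selfadjoint x ->
  (forall t, rspec x t -> g t%:C = h t%:C) ->
  poly_limit x g y -> poly_limit x h z -> y = z.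
Proof.
move=> hx gh gy hz; apply/subr0_eq/rn_eq0/le_anti; rewrite rn_ge0 andbT.
apply/ler_addgt0Pr => e e0; rewrite add0r.
have e40 : 0 < e / 4 by rewrite divr_gt0.
have [p p1 p2] := gy _ e40; have [q q1 q2] := hz _ e40.
have pq : rn (pev x (p - q)) <= e / 2.
  apply: rn_pev_le => //; first by rewrite divr_ge0 ?(ltW e0).
  move=> t xt; rewrite hornerD hornerN.
  have -> : p.[t%:C] - q.[t%:C] = (p.[t%:C] - g t%:C) - (q.[t%:C] - h t%:C).
    by rewrite gh// opprB addrA subrK.
  apply: le_trans (rnD _ _) _; rewrite rnN.
  by have := p1 _ xt; have := q1 _ xt; lra.
have -> : y - z = - (pev x p - y) + (pev x (p - q) + (pev x q - z)).
  by rewrite pevB opprB (addrA (pev x p - pev x q)) subrK addrA subrK.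
apply: le_trans (rnD _ _) _; rewrite rnN.
have := rnD (pev x (p - q)) (pev x q - z); lra.
Qed.

Lemma poly_limit_ex x g : selfadjoint x -> spectrum_continuous x g ->
  exists y, poly_limit x g y.
Proof.
move=> hx cg.
have n0 n : 0 < n.+1%:R^-1 :> R by rewrite invr_gt0 ltr0n.
have [n|p hp] := @choice _ _ (fun n p =>
    forall t, rspec x t -> rn (p.[t%:C] - g t%:C) <= n.+1%:R^-1).
  exact: spec_weierstrass.
have inv_le (e : R) : 0 < e ->
    exists N : nat, forall n : nat, (N <= n)%N -> n.+1%:R^-1 < e.
  move=> e0; exists (Num.truncn e^-1) => n Nn.
  have /truncn_itv/andP[_ h] : 0 <= e^-1 by rewrite invr_ge0 ltW.
  rewrite -[e]invrK ltf_pV2 ?posrE ?invr_gt0 ?ltr0n//.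
  by apply: lt_le_trans h _; rewrite ler_nat.
have [e e0|y hy] := @rn_complete R A (fun n => pev x (p n)).
  have e30 : 0 < e / 2 by rewrite divr_gt0.
  have [N hN] := inv_le _ e30; exists N => m n Nm Nn.
  rewrite -pevB; apply: (@le_lt_trans _ _ (m.+1%:R^-1 + n.+1%:R^-1)); last first.
    by rewrite [e]splitr; apply: ltrD; apply: hN.
  apply: rn_pev_le => // t xt; rewrite hornerD hornerN.
  have -> : (p m).[t%:C] - (p n).[t%:C] =
      ((p m).[t%:C] - g t%:C) - ((p n).[t%:C] - g t%:C).
    by rewrite opprB addrA subrK.
  apply: le_trans (rnD _ _) _; rewrite rnN.
  by apply: lerD; apply: hp.
exists y => e e0; have [N1 hN1] := hy _ e0; have [N2 hN2] := inv_le _ e0.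
exists (p (N1 + N2)%N) => [t xt|]; last by apply/ltW/hN1; rewrite leq_addr.
by apply: le_trans (hp _ _ xt) _; apply/ltW/hN2; rewrite leq_addl.
Qed.

Lemma poly_limit_pev x p g : (forall t, g t%:C = p.[t%:C]) -> poly_limit x g (pev x p).
Proof.
by move=> gp e e0; exists p => [t xt|]; rewrite ?gp subrr rn0 ltW.
Qed.

Lemma poly_limitD x g h y z : poly_limit x g y -> poly_limit x h z ->
  poly_limit x (fun k => g k + h k) (y + z).
Proof.
move=> gy hz e e0; have e20 : 0 < e / 2 by rewrite divr_gt0.
have [p p1 p2] := gy _ e20; have [q q1 q2] := hz _ e20.
exists (p + q) => [t xt|].
  rewrite hornerD opprD addrACA; apply: le_trans (rnD _ _) _.
  by have := p1 _ xt; have := q1 _ xt; lra.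
rewrite pevD opprD addrACA; apply: le_trans (rnD _ _) _; lra.
Qed.

Lemma poly_limitZ x g y k : poly_limit x g y -> poly_limit x (fun l => k * g l) (k *: y).
Proof.
move=> gy e e0; have k0 : 0 < rn k + 1 by rewrite ltr_wpDl ?rn_ge0.
have e10 : 0 < e / (rn k + 1) by rewrite divr_gt0.
have ke : rn k * (e / (rn k + 1)) <= e.
  by rewrite mulrCA ler_piMr ?(ltW e0)// ler_pdivrMr// mul1r lerDl.
have [p p1 p2] := gy _ e10; exists (k *: p) => [t xt|].
  rewrite hornerZ -mulrBr rnCM; apply: le_trans ke.
  by apply: ler_wpM2l; [exact: rn_ge0|exact: p1].
rewrite pevZ -scalerBr rnZ; apply: le_trans ke.
by apply: ler_wpM2l => //; exact: rn_ge0.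
Qed.

Lemma poly_limit_star x g y : selfadjoint x -> poly_limit x g y ->
  poly_limit x (fun k => Num.conj (g k)) (star y).
Proof.
move=> hx gy e e0; have [p p1 p2] := gy _ e0.
exists (map_poly Num.conj p) => [t xt|]; last by rewrite -star_pev// -starB rn_star.
have -> : (map_poly Num.conj p).[t%:C] = Num.conj p.[t%:C].
  by rewrite -horner_map/= conjR.
by rewrite -rmorphB/= rnJ; apply: p1.
Qed.

Lemma poly_limitM x g h y z (B C : R) :
  (forall t, rspec x t -> rn (g t%:C) <= B) ->
  (forall t, rspec x t -> rn (h t%:C) <= C) -> 0 <= B -> 0 <= C ->
  poly_limit x g y -> poly_limit x h z -> poly_limit x (fun k => g k * h k) (y * z).
Proof.
move=> gB hC B0 C0 gy hz e e0.
pose M := B + C + rn y + rn z + 1.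
have y0 := rn_ge0 y; have z0 := rn_ge0 z.
have M0 : 0 < M by rewrite /M; lra.
(* Small enough for d <= 1 and d * M <= e at the same time. *)
pose d := e / (M + e).
have d0 : 0 < d by rewrite divr_gt0// addr_gt0.
have Me : 0 < M + e by rewrite addr_gt0.
have d1 : d <= 1 by rewrite /d (ler_pdivrMr _ _ Me) mul1r lerDr ltW.
have dM : d * M <= e.
  by rewrite /d mulrAC -mulrA ler_piMr ?(ltW e0)// (ler_pdivrMr _ _ Me) mul1r lerDl ltW.
have [p p1 p2] := gy _ d0; have [q q1 q2] := hz _ d0.
have key (u v b c : R) : 0 <= u -> 0 <= v -> 0 <= b -> 0 <= c ->
    u <= d -> v <= d -> b + c + 1 <= M -> u * (v + c) + b * v <= e.
  move=> u0 v0 b0 c0 ud vd bc; apply: le_trans dM.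
  apply: (@le_trans _ _ (d * (1 + c) + b * d)).
    apply: lerD; last by apply: ler_wpM2l.
    apply: ler_pM => //; first exact: addr_ge0.
    by rewrite lerD2r; apply: le_trans d1.
  have := ltW d0; nra.
exists (p * q) => [t xt|].
- have -> : (p * q).[t%:C] - g t%:C * h t%:C =
     (p.[t%:C] - g t%:C) * ((q.[t%:C] - h t%:C) + h t%:C)
       + g t%:C * (q.[t%:C] - h t%:C) by rewrite hornerM; ring.
  apply: le_trans (rnD _ _) _; rewrite !rnCM.
  apply: (@le_trans _ _ (rn (p.[t%:C] - g t%:C) *
      (rn (q.[t%:C] - h t%:C) + C) + B * rn (q.[t%:C] - h t%:C))).
    apply: lerD; last by apply: ler_wpM2r; [exact: rn_ge0|exact: gB].
    apply: ler_wpM2l; first exact: rn_ge0.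
    by apply: le_trans (rnD _ _) _; rewrite lerD2l hC.
  apply: key; rewrite ?rn_ge0//; [exact: p1|exact: q1|rewrite /M; lra].
- have -> : pev x (p * q) - y * z =
     (pev x p - y) * ((pev x q - z) + z) + y * (pev x q - z).
    by rewrite pevM subrK mulrBl mulrBr addrA subrK.
  apply: le_trans (rnD _ _) _.
  apply: (@le_trans _ _ (rn (pev x p - y) * (rn (pev x q - z) + rn z)
      + rn y * rn (pev x q - z))).
    apply: lerD; last exact: rnM.
    apply: le_trans (rnM _ _) _; apply: ler_wpM2l; first exact: rn_ge0.
    exact: rnD.
  by apply: key; rewrite ?rn_ge0// /M; lra.
Qed.

(** By [rn_pev_le] a function g determines its limit element, and the limit
inherits the algebraic laws from polynomials; by [spec_weierstrass] and
completeness it exists. *)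
Theorem functional_calculus_ex x : selfadjoint x -> exists Phi, functional_calculus x Phi.
Proof.
move=> hx; pose Phi g : A := xget 0 [set y | poly_limit x g y].
have PhiE g y : poly_limit x g y -> Phi g = y.
  move=> gy; apply: (@poly_limit_uniq x g g) => //.
  by apply: (@xgetPex _ 0 [set y | poly_limit x g y]); exists y.
have PhiP g : spectrum_continuous x g -> poly_limit x g (Phi g).
  move=> /(poly_limit_ex hx) ex; exact: (@xgetPex _ 0 [set y | poly_limit x g y]).
have bd g : spectrum_continuous x g ->
    exists2 B, 0 <= B & forall t, rspec x t -> rn (g t%:C) <= B.
  move=> /(spec_contP _ hx); apply: econt_bounded; exact: rspec_compact.
exists Phi; split.
- move=> g h cg ch gh; apply: (@poly_limit_uniq x g h) => //; try exact: PhiP.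
  by move=> t xt; apply: gh; rewrite inE.
- by move=> g h /PhiP cg /PhiP ch; apply: PhiE; apply: poly_limitD.
- by move=> k g /PhiP cg; apply: PhiE; apply: poly_limitZ.
- move=> g h cg ch; have [B B0 hB] := bd _ cg; have [C C0 hC] := bd _ ch.
  by apply: PhiE; apply: (poly_limitM hB hC B0 C0); apply: PhiP.
- by move=> g /PhiP cg; apply: PhiE; apply: poly_limit_star.
- apply: PhiE; rewrite -[in X in poly_limit _ _ X](scale1r (1 : A)) -(pevC x).
  by apply: poly_limit_pev => t; rewrite hornerC.
- apply: PhiE; rewrite -[X in poly_limit _ _ X](pevX x).
  by apply: poly_limit_pev => t; rewrite hornerX.
Qed.

Lemma cfcP (f : R -> R) x : selfadjoint x -> exists2 Phi, functional_calculus x Phi &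
  cfc f x = Phi (fun k => (f (complex.Re k))%:C).
Proof.
move=> hx; have [Phi hPhi] := functional_calculus_ex hx.
have [|Psi hPsi e] := @xgetPex _ 0 [set y | exists2 Phi, functional_calculus x Phi &
                    y = Phi (fun k => (f (complex.Re k))%:C)]; last by exists Psi.
by exists (Phi (fun k => (f (complex.Re k))%:C)), Phi.
Qed.

End FunctionalCalculus.

(** * Calculus with real functions *)

Section ContinuousWithin.
Context {R : realType}.
Implicit Types (J : set R) (f g : R -> R) (s t : R).

Local Notation cont J f := {within J, continuous (f : R -> R)}.

Lemma cont_cst J s : cont J (fun=> s).
Proof. by move=> t; apply: cvg_cst. Qed.

Lemma cont_id J : cont J (fun t => t).
Proof. by apply: continuous_subspaceT => t; apply: cvg_id. Qed.

Lemma contD J f g : cont J f -> cont J g -> cont J (fun t => f t + g t).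
Proof. by move=> cf cg t; apply: cvgD; [exact: cf|exact: cg]. Qed.

Lemma contM J f g : cont J f -> cont J g -> cont J (fun t => f t * g t).
Proof. by move=> cf cg t; apply: cvgM; [exact: cf|exact: cg]. Qed.

Lemma contN J f : cont J f -> cont J (fun t => - f t).
Proof. by move=> cf t; apply: cvgN; exact: cf. Qed.

Lemma contB J f g : cont J f -> cont J g -> cont J (fun t => f t - g t).
Proof. by move=> cf /contN; apply: contD. Qed.

Lemma cont_max0 J f : cont J f -> cont J (fun t => Num.max 0 (f t)).
Proof.
move=> cf.
have -> : (fun t => Num.max 0 (f t)) = (fun t => 2^-1 * (f t + `|f t|)).
  apply/funext => t; case: leP => h.
    by rewrite (ger0_norm h); field.
  by rewrite (ltr0_norm h) subrr mulr0.
apply: contM; first exact: cont_cst.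
by move=> t; apply: cvgD; [exact: cf|apply: cvg_norm; exact: cf].
Qed.

Lemma cont_sqrt J f : cont J f -> cont J (fun t => Num.sqrt (f t)).
Proof.
by move=> cf t; apply: continuous_comp (cf t) _; apply: sqrt_continuous.
Qed.

Lemma cont_sum J (I : Type) (r : seq I) (F : I -> R -> R) :
  (forall i, cont J (F i)) -> cont J (fun t => \sum_(i <- r) F i t).
Proof.
move=> cF; elim: r => [|i r IH].
  have -> : (fun t => \sum_(i <- [::]) F i t) = (fun=> 0).
    by apply/funext => t; rewrite big_nil.
  exact: cont_cst.
have -> : (fun t => \sum_(j <- i :: r) F j t) = (fun t => F i t + \sum_(j <- r) F j t).
  by apply/funext => t; rewrite big_cons.
exact: contD.
Qed.

End ContinuousWithin.

Section RealCalculus.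
Context {R : realType} {A : cstarAlgType R}.
Implicit Types (t s : R) (f g : R -> R).

Local Notation sc k := (k *: (1 : A)).
Local Notation cont J f := {within J, continuous (f : R -> R)}.

(** The value f(x) in the calculus Phi of x, for a real function f. *)
Definition rcalc (Phi : (R[i] -> R[i]) -> A) f : A :=
  Phi (fun k => (f (complex.Re k))%:C).

Variables (x : A) (Phi : (R[i] -> R[i]) -> A) (J : set R).
Hypotheses (hx : selfadjoint x) (hPhi : functional_calculus x Phi).
Hypothesis xJ : forall t, rspec x t -> J t.

Lemma rcalc_cont f : cont J f -> spectrum_continuous x (fun k => (f (complex.Re k))%:C).
Proof.
move=> /subspace_continuousP cf; apply/(spec_contP _ hx) => t xt e e0 /=.
have /cvgrPdist_lt/(_ e e0)/nbhs_ballP[d d0 hd] := cf _ (xJ xt).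
exists d => // s xs st; rewrite -rmorphB/= rnR distrC.
by apply: hd (xJ xs); rewrite /ball/= distrC.
Qed.

Lemma rcalc_ext f g : cont J f -> cont J g -> (forall t, J t -> f t = g t) ->
  rcalc Phi f = rcalc Phi g.
Proof.
move=> cf cg fg; apply: (fcal_ext hPhi); [exact: rcalc_cont|exact: rcalc_cont|].
move=> k; rewrite inE => xk; have kE := spec_real hx xk.
by rewrite /= fg//; apply: xJ; rewrite /rspec/= -kE.
Qed.

Lemma rcalcD f g : cont J f -> cont J g ->
  rcalc Phi (fun t => f t + g t) = rcalc Phi f + rcalc Phi g.
Proof.
move=> cf cg; rewrite /rcalc -(fcal_add hPhi) //; try exact: rcalc_cont.
by congr Phi; apply/funext => k; rewrite rmorphD.
Qed.

Lemma rcalcM f g : cont J f -> cont J g ->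
  rcalc Phi (fun t => f t * g t) = rcalc Phi f * rcalc Phi g.
Proof.
move=> cf cg; rewrite /rcalc -(fcal_mul hPhi) //; try exact: rcalc_cont.
by congr Phi; apply/funext => k; rewrite rmorphM.
Qed.

Lemma rcalcZ s f : cont J f -> rcalc Phi (fun t => s * f t) = s%:C *: rcalc Phi f.
Proof.
move=> cf; rewrite /rcalc -(fcal_scale hPhi); last exact: rcalc_cont.
by congr Phi; apply/funext => k; rewrite rmorphM.
Qed.

Lemma rcalc_sa f : cont J f -> selfadjoint (rcalc Phi f).
Proof.
move=> cf; rewrite /selfadjoint /rcalc -(fcal_star hPhi); last exact: rcalc_cont.
by congr Phi; apply/funext => k; exact: conjc_real.
Qed.

Lemma rcalc1 : rcalc Phi (fun=> 1) = 1.
Proof. by rewrite -(fcal_one hPhi). Qed.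

Lemma rcalc_cst s : rcalc Phi (fun=> s) = sc s%:C.
Proof.
rewrite -rcalc1 -rcalcZ; last exact: cont_cst.
by rewrite mulr1.
Qed.

Lemma rcalc_id : rcalc Phi (fun t => t) = x.
Proof.
rewrite -[RHS](fcal_id hPhi); apply: (fcal_ext hPhi).
- by apply: (@rcalc_cont (fun t => t)); apply: cont_id.
- apply/(spec_contP _ hx) => t _ e e0; exists e => // s _.
  by rewrite -rmorphB/= rnR.
- by move=> k; rewrite inE => /(spec_real hx).
Qed.

Lemma rcalc_affine s t : rcalc Phi (fun u => s * u + t) = s%:C *: x + sc t%:C.
Proof.
rewrite rcalcD; [|apply: contM; [exact: cont_cst|exact: cont_id]|exact: cont_cst].
by rewrite rcalcZ ?rcalc_id ?rcalc_cst//; apply: cont_id.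
Qed.

Lemma rcalcB f g : cont J f -> cont J g ->
  rcalc Phi (fun t => f t - g t) = rcalc Phi f - rcalc Phi g.
Proof.
move=> cf cg; rewrite rcalcD//; last exact: contN.
congr (_ + _).
rewrite -scaleN1r -(rmorphN1 (real_complex R)) -rcalcZ//.
by congr rcalc; apply/funext => t; rewrite mulN1r.
Qed.

Lemma rcalc_sum (I : Type) (r : seq I) (F : I -> R -> R) :
  (forall i, cont J (F i)) ->
  rcalc Phi (fun t => \sum_(i <- r) F i t) = \sum_(i <- r) rcalc Phi (F i).
Proof.
move=> cF; elim: r => [|i r IH].
  rewrite big_nil -[RHS](scale0r (1 : A)) -(rcalc_cst 0).
  by congr rcalc; apply/funext => t; rewrite big_nil.
rewrite big_cons -IH -rcalcD//; last exact: cont_sum.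
by congr rcalc; apply/funext => t; rewrite big_cons.
Qed.

Lemma rcalc_sqrt f : cont J f -> (forall t, J t -> 0 <= f t) ->
  rcalc Phi (fun t => Num.sqrt (f t)) * rcalc Phi (fun t => Num.sqrt (f t)) =
  rcalc Phi f.
Proof.
move=> cf f0; have cs := cont_sqrt cf.
rewrite -rcalcM//; apply: rcalc_ext => // [|t Jt]; first exact: contM.
by rewrite -expr2 sqr_sqrtr// f0.
Qed.

Lemma rcalc_ge0 f : cont J f -> (forall t, J t -> 0 <= f t) -> cpos (rcalc Phi f).
Proof.
move=> cf f0; rewrite -rcalc_sqrt//.
by apply: cpos_sqr; apply: rcalc_sa; apply: cont_sqrt.
Qed.

End RealCalculus.

(** * Positivity of star z * z *)

Section Positivity.
Context {R : realType} {A : cstarAlgType R}.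
Implicit Types (x y z b v : A) (t s : R).

Local Notation sc k := (k *: (1 : A)).

Lemma cpos_root b : cpos b -> exists2 d, selfadjoint d & b = d * d.
Proof.
move=> hb; have hs := cpos_sa hb.
have [Phi hPhi] := functional_calculus_ex hs.
pose J : set R := [set t | 0 <= t].
have bJ t : rspec b t -> J t by move=> /(cpos_spec hb).
have cid := @cont_id R J.
exists (rcalc Phi (fun t => Num.sqrt t)).
  by apply: (rcalc_sa hs hPhi bJ); apply: cont_sqrt.
by rewrite (rcalc_sqrt hs hPhi bJ cid)// (rcalc_id hs hPhi bJ).
Qed.

Lemma cposZK t b : 0 < t -> cpos (t%:C *: b) -> cpos b.
Proof.
move=> t0 /(cposZ (t:=t^-1)); rewrite invr_ge0 ltW// => /(_ isT).
by rewrite scalerA -rmorphM/= mulVf ?gt_eqF// scale1r.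
Qed.

(** Twice the element is p^2 + q^2 for the selfadjoint p = v + v^* and q = i (v
- v^* ). *)
Lemma cpos_starD v : cpos (star v * v + v * star v).
Proof.
pose i : R[i] := Complex 0 1.
have ic : Num.conj i = - i.
  by apply/eqP; rewrite eq_complex/= oppr0 !eqxx.
have ii : i * i = -1.
  by apply/eqP; rewrite eq_complex/= !(mul0r, mulr0, addr0, add0r) mulr1 oppr0 !eqxx.
pose p := v + star v; pose q := i *: (v - star v).
have hp : selfadjoint p by rewrite /selfadjoint /p starD starK addrC.
have hq : selfadjoint q.
  by rewrite /selfadjoint /q starZ starB starK ic scaleNr -scalerN opprB.
apply: (@cposZK 2) => //.
have -> : 2%:C *: (star v * v + v * star v) = p * p + q * q.
  rewrite /p /q mulZl mulZr scalerA ii scaleN1r.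
  have -> : (v + star v) * (v + star v) =
      (v * v + star v * star v) + (star v * v + v * star v).
    rewrite mulrDl !mulrDr (addrC (star v * v)) addrACA.
    by rewrite (addrC (v * star v)).
  have -> : (v - star v) * (v - star v) =
      (v * v + star v * star v) - (star v * v + v * star v).
    rewrite mulrBl !mulrBr opprB addrACA -opprD.
    by rewrite (addrC (v * star v)).
  by rewrite opprB [RHS]addrC addrA subrK rmorph_nat scaler_nat mulr2n.
by apply: cposD; apply: cpos_sqr.
Qed.

(** Kaplansky's argument. Let n be the negative part of w = star z * z, and v =
z n. Then star v * v = n w n = - n^3 is negative, so v * star v, which is a
positive element minus star v * v, is positive. Both products have the same
nonzero spectrum, so star v * v is positive as well, hence 0. Thus n^3 = 0, n =
0, and w equals its positive part. *)
Lemma cpos_starM z : cpos (star z * z).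
Proof.
pose w := star z * z; have hw : selfadjoint w by exact: sa_star.
have [Phi hPhi] := functional_calculus_ex hw.
have wT t : rspec w t -> setT t by [].
have cid := @cont_id R setT.
pose neg (t : R) := Num.max 0 (- t); pose pos (t : R) := Num.max 0 t.
have cneg : {within setT, continuous neg} by apply: cont_max0; apply: contN.
have cont_pos : {within setT, continuous pos} by apply: cont_max0.
have cneg2 := contM cneg cneg.
have cneg3 := contM cneg cneg2.
have neg0 t : 0 <= neg t by rewrite /neg le_max lexx.
pose n := rcalc Phi neg.
have hn : selfadjoint n := rcalc_sa hw hPhi wT cneg.
pose v := z * n.
have vv : star v * v = - rcalc Phi (fun t => neg t * (neg t * neg t)).
  rewrite /v starMr hn mulrA -(mulrA n) -/w.
  rewrite -[w](rcalc_id hw hPhi wT) -!(rcalcM hw hPhi wT)//; last exact: contM.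
  rewrite -scaleN1r -(rmorphN1 (real_complex R)) -(rcalcZ hw hPhi wT)//.
  congr rcalc; apply/funext => t; rewrite /neg; case: leP => h; first by ring.
  by rewrite !mul0r mulr0.
have vv1 : cpos (- (star v * v)).
  by rewrite vv opprK; apply: (rcalc_ge0 hw hPhi wT) => // t _; rewrite !mulr_ge0.
have vv2 : cpos (v * star v).
  have -> : v * star v = (star v * v + v * star v) + - (star v * v).
    by rewrite addrC addrA addNr add0r.
  by apply: cposD vv1; exact: cpos_starD.
have vv3 : cpos (star v * v).
  have hs := sa_star v; split => //; apply/(spec_inP _ hs) => t ht /=.
  have [->|t0] := eqVneq t 0; first by [].
  apply: (cpos_spec vv2); apply: spec_swap => //.
  by apply: contra t0 => /eqP/complexI ->.
have n3 : rcalc Phi (fun t => neg t * (neg t * neg t)) = 0.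
  by apply/oppr_inj; rewrite -vv oppr0; apply: cpos_anti.
have n0 : n = 0.
  apply: rn_eq0; have : rn (n * n * (n * n)) = 0.
    have -> : n * n * (n * n) = n * rcalc Phi (fun t => neg t * (neg t * neg t)).
      by rewrite (rcalcM hw hPhi wT)// (rcalcM hw hPhi wT)// -/n !mulrA.
    by rewrite n3 mulr0 rn0.
  rewrite rn_sqr; last exact: saM.
  by rewrite rn_sqr// => /eqP; rewrite !expf_eq0/= => /eqP.
have : w = rcalc Phi pos - n.
  rewrite -[LHS](rcalc_id hw hPhi wT) -(rcalcB hw hPhi wT)//.
  congr rcalc; apply/funext => t; rewrite /pos /neg; case: leP => h.
    by rewrite max_l ?subr0 ?oppr_le0.
  by rewrite max_r ?oppr_ge0 ?(ltW h)// opprK add0r.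
rewrite n0 subr0 -/w => ->; apply: (rcalc_ge0 hw hPhi wT) => // t _.
by rewrite /pos le_max lexx.
Qed.

Lemma cpos_starr z : cpos (z * star z).
Proof. by have := cpos_starM (star z); rewrite starK. Qed.

Lemma cpos_conj b z : cpos b -> cpos (star z * b * z).
Proof.
move=> /cpos_root[d hd ->].
have -> : star z * (d * d) * z = star (d * z) * (d * z).
  by rewrite starMr hd !mulrA.
exact: cpos_starM.
Qed.

Lemma cpos_Bscalar x t : selfadjoint x ->
  cpos (x - sc t%:C) <-> (forall s, rspec x s -> t <= s).
Proof.
move=> hx; have hs : selfadjoint (x - sc t%:C) by apply: saB => //; apply: saC.
split=> [h s xs|h].
  rewrite -subr_ge0; apply: (cpos_spec h); rewrite rmorphB/= -scaleNr.
  exact: spec_shift.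
split=> //; apply/(spec_inP _ hs) => s xs /=.
have := spec_shift (l := t%:C) xs; rewrite subrK -rmorphD/= => /h.
by rewrite lerDr.
Qed.

Lemma cpos_scalarB x t : selfadjoint x ->
  cpos (sc t%:C - x) <-> (forall s, rspec x s -> s <= t).
Proof.
move=> hx; have hs : selfadjoint (sc t%:C - x) by apply: saB => //; apply: saC.
split=> [h s xs|h].
  rewrite -subr_ge0; apply: (cpos_spec h); apply/spec_sub.
  by rewrite -rmorphB/= opprB addrC subrK.
split=> //; apply/(spec_inP _ hs) => s /spec_sub /=.
by rewrite -rmorphB/= => /h; rewrite gerBl.
Qed.

End Positivity.

(** * Affine minorants of a convex function *)

Section ConvexMinorants.
Context {R : realType}.
Implicit Types (f : R -> R) (I : set R) (a b m M t e : R).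

Lemma convex_function_chord I f a b t : convex_function I f -> I a -> I b ->
  a < b -> a <= t <= b -> f t * (b - a) <= f a * (b - t) + f b * (t - a).
Proof.
move=> cf Ia Ib ab /andP[ta tb]; have ba : 0 < b - a by rewrite subr_gt0.
have p0 : 0 <= (b - t) / (b - a) by rewrite divr_ge0 ?(ltW ba)// subr_ge0.
have p1 : (b - t) / (b - a) <= 1 by rewrite ler_pdivrMr// mul1r lerD2l lerN2.
have := cf (Itv01 p0 p1) a b; rewrite !inE => /(_ Ia Ib).
have -> : conv (Itv01 p0 p1) (a : convex_lmodType R^o) (b : convex_lmodType R^o) = t.
  change ((b - t) / (b - a) * a + (1 - (b - t) / (b - a)) * b = t).
  by field; rewrite gt_eqF.
move=> h0; have {h0} h :
    f t <= (b - t) / (b - a) * f a + (1 - (b - t) / (b - a)) * f b := h0.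
have -> : f a * (b - t) + f b * (t - a) =
    ((b - t) / (b - a) * f a + (1 - (b - t) / (b - a)) * f b) * (b - a).
  by field; rewrite gt_eqF.
by rewrite ler_pM2r.
Qed.

(** Near a point c, take the chord of f over a small interval [a, b] around c.
By convexity the chord lies above f on [a, b] and below f outside; lowering it
by twice the oscillation of f on [a, b] gives an affine minorant close to f near
c. Chords exist at the end points of [m, M] too, where f may have no tangent of
finite slope. Compactness leaves finitely many of them. *)
Lemma affine_minorants I f m M e : convex_function I f ->
  (forall t, m <= t <= M -> I t) -> {within `[m, M], continuous f} ->
  m <= M -> 0 < e ->
  exists L : seq (R * R),
    (forall l, l \in L -> forall t, m <= t <= M -> l.1 * t + l.2 <= f t) /\
    (forall t, m <= t <= M -> exists2 l, l \in L & f t - e < l.1 * t + l.2).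
Proof.
move=> cf JI contf mM e0.
pose minor (l : R * R) := forall t, m <= t <= M -> l.1 * t + l.2 <= f t.
suff [L hL] : exists L : seq (R * R), forall t, `[m, M]%classic t ->
    exists2 l, l \in L & minor l /\ f t - e < l.1 * t + l.2.
  exists [seq l <- L | `[< minor l >]]; split.
    by move=> l; rewrite mem_filter => /andP[/asboolP].
  move=> t mt; have [|l lL [h1 h2]] := hL t; first by rewrite /= in_itv.
  by exists l => //; rewrite mem_filter lL andbT; apply/asboolP.
apply: (compact_finite_choice (Q := fun l t => minor l /\ f t - e < l.1 * t + l.2)).
  exact: segment_compact.
move=> c; rewrite /= in_itv/= => mc.
have e30 : 0 < e / 3 by rewrite divr_gt0.
have [mM'|mM'] := eqVneq m M.
  exists 1, (0, f m - e / 3); split=> //.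
  have one t : m <= t <= M -> t = m by rewrite -mM' => /le_anti.
  split=> [t /one -> /=|]; first by lra.
  by move: H; rewrite /= in_itv/= => /one -> /=; lra.
have {mM'}mM : m < M by rewrite lt_neqAle mM' mM.
have /subspace_continuousP/(_ c) := contf; rewrite /= in_itv/= => /(_ mc).
move=> /cvgrPdist_lt/(_ _ e30)/nbhs_ballP[d /= d0 hd].
have near t : m <= t <= M -> `|c - t| < d -> `|f c - f t| < e / 3.
  by move=> mt ct; apply: hd; rewrite ?in_itv.
pose a := Num.max m (c - d / 2); pose b := Num.min M (c + d / 2).
have [mc1 mc2] := andP mc.
have am : m <= a by rewrite le_max lexx.
have ac : a <= c by rewrite ge_max mc1/=; lra.
have bM : b <= M by rewrite ge_min lexx.
have bc : c <= b by rewrite le_min mc2/=; lra.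
have ad : c - d / 2 <= a by rewrite le_max lexx orbT.
have bd : b <= c + d / 2 by rewrite ge_min lexx orbT.
have ab : a < b.
  by rewrite /a /b lt_min !gt_max; apply/andP; split; apply/andP; split; lra.
have ba : 0 < b - a by rewrite subr_gt0.
have Ia : I a by apply: JI; lra.
have Ib : I b by apply: JI; lra.
have inab t : a <= t <= b -> `|f c - f t| < e / 3.
  by move=> /andP[h1 h2]; apply: near; [lra|rewrite ltr_norml; lra].
pose k := (f b - f a) / (b - a).
pose Li t := k * t + (f a - k * a).
have LiE t : Li t * (b - a) = f a * (b - t) + f b * (t - a).
  by rewrite /Li /k; field; rewrite gt_eqF.
have fa : `|f c - f a| < e / 3 by apply: inab; rewrite lexx ltW.
have fb : `|f c - f b| < e / 3 by apply: inab; rewrite lexx ltW.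
move: fa fb; rewrite !ltr_norml => fa fb.
have Li_le t : a <= t <= b -> Li t <= f c + e / 3.
  move=> /andP[h1 h2]; rewrite -(ler_pM2r ba) LiE.
  have : 0 <= (f c + e / 3 - f a) * (b - t) by apply: mulr_ge0; lra.
  have : 0 <= (f c + e / 3 - f b) * (t - a) by apply: mulr_ge0; lra.
  by nra.
(* The chord exceeds f by at most twice the oscillation e / 3 on [a, b]. *)
exists (d / 2), (k, f a - k * a - 2 * (e / 3)); split; first by rewrite divr_gt0.
move=> s; rewrite in_itv/= => ms; rewrite ltr_norml => sc; split.
- move=> t mt /=; rewrite addrA -/(Li t).
  have [tab|] := boolP (a <= t <= b).
    have := Li_le _ tab; have := inab _ tab; rewrite ltr_norml; lra.
  rewrite negb_and -!ltNge => out; apply: (@le_trans _ _ (Li t)); first lra.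
  rewrite -(ler_pM2r ba) LiE.
  case/orP: out => h.
  + have := convex_function_chord cf (JI _ mt) Ib (lt_trans h ab) (t := a).
    have -> : t <= a <= b by rewrite !ltW.
    by move=> /(_ isT); lra.
  + have := convex_function_chord cf Ia (JI _ mt) (lt_trans ab h) (t := b).
    have -> : a <= b <= t by rewrite !ltW.
    by move=> /(_ isT); lra.
- rewrite /= addrA -/(Li s).
  have sab : a <= s <= b.
    by rewrite /a /b ge_max le_min; apply/andP; split; apply/andP; split; lra.
  have : f s <= Li s.
    by rewrite -(ler_pM2r ba) LiE; apply: (convex_function_chord cf).
  lra.
Qed.

End ConvexMinorants.

(** * The trace inequality on the positive cone *)

Section TraceJensen.
Context {R : realType} {A : cstarAlgType R}.
Implicit Types (x y z b : A) (f : R -> R) (t s e : R).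

Local Notation sc k := (k *: (1 : A)).

(** What the real part of a finite trace and an extended trace with finite
values on the positive cone have in common. *)
Record cone_trace (T : A -> R) : Prop := {
  cone_trace_ge0 : forall x, cpos x -> 0 <= T x ;
  cone_traceD : forall x y, cpos x -> cpos y -> T (x + y) = T x + T y ;
  cone_traceZ : forall t x, 0 <= t -> cpos x -> T (t%:C *: x) = t * T x ;
  cone_trace_star : forall z, T (star z * z) = T (z * star z)
}.

Variables (T : A -> R) (hT : cone_trace T).

Let T_ge0 := cone_trace_ge0 hT.
Let TD := cone_traceD hT.
Let TZ := cone_traceZ hT.
Let T_star := cone_trace_star hT.

Lemma cone_trace_sum (J : Type) (r : seq J) (F : J -> A) :
  (forall j, cpos (F j)) -> T (\sum_(j <- r) F j) = \sum_(j <- r) T (F j).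
Proof.
move=> hF; elim: r => [|j r IH].
  by rewrite !big_nil -(scale0r (0 : A)) (TZ (lexx 0) cpos0) mul0r.
by rewrite !big_cons TD ?IH//; apply: cpos_sum.
Qed.

Lemma cone_trace_le x y : cpos x -> cpos (y - x) -> T x <= T y.
Proof.
by move=> hx hyx; rewrite -(subrK x y) addrC TD// lerDl T_ge0.
Qed.

(** With b = d^2, the trace moves u_j from the middle of d u_j^2 d, where the
sum over j collapses, to the outside. *)
Lemma cone_trace_pinching (J : Type) (r : seq J) (u : J -> A) b :
  (forall j, selfadjoint (u j)) -> \sum_(j <- r) u j * u j = 1 -> cpos b ->
  T b = \sum_(j <- r) T (u j * b * u j).
Proof.
move=> hu u1 /cpos_root[d hd ->].
have dd : d * d = \sum_(j <- r) (d * u j) * star (d * u j).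
  rewrite -{1}(mulr1 d) -u1 mulr_sumr mulr_suml; apply: eq_bigr => j _.
  by rewrite starMr hd hu !mulrA.
rewrite {1}dd cone_trace_sum; last by move=> j; apply: cpos_starr.
by apply: eq_bigr => j _; rewrite -T_star starMr hd hu !mulrA.
Qed.

Lemma trace_jensen_nonneg (I : set R) f (n : nat) (x a : 'I_n -> A) (m M : R)
    (Phi : 'I_n -> (R[i] -> R[i]) -> A) (Psi : (R[i] -> R[i]) -> A) :
  let y := \sum_(i < n) star (a i) * x i * a i in
  convex_function I f -> (forall t, m <= t <= M -> I t) ->
  {within `[m, M], continuous f} -> m <= M ->
  (forall t, m <= t <= M -> 0 <= f t) ->
  (forall i, selfadjoint (x i)) ->
  (forall i t, rspec (x i) t -> `[m, M]%classic t) ->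
  (forall t, rspec y t -> `[m, M]%classic t) ->
  \sum_(i < n) star (a i) * a i = 1 ->
  (forall i, functional_calculus (x i) (Phi i)) -> functional_calculus y Psi ->
  T (rcalc Psi f) <= T (\sum_(i < n) star (a i) * rcalc (Phi i) f * a i).
Proof.
move=> y cf JI contf mM f0 hx xJ yJ a1 hPhi hPsi.
pose J : set R := `[m, M]%classic.
have JP t : J t -> m <= t <= M by rewrite /J/= in_itv.
have hy : selfadjoint y by apply: sa_sum => i _; apply: sa_conj.
set b := \sum_(i < n) _.
have hb : cpos b.
  apply: cpos_sum => i _; apply: cpos_conj.
  by apply: (rcalc_ge0 (hx i) (hPhi i) (xJ i) contf) => t /JP; apply: f0.
have hfy : cpos (rcalc Psi f).
  by apply: (rcalc_ge0 hy hPsi yJ contf) => t /JP; apply: f0.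
suff main e : 0 < e -> T (rcalc Psi f) <= T b + e * T 1.
  have T1 : 0 <= T 1 by apply: T_ge0; rewrite -(mulr1 1); apply/cpos_sqr/sa1.
  apply/ler_addgt0Pr => e e0.
  have e1 : 0 < e / (T 1 + 1) by rewrite divr_gt0// ltr_wpDl.
  apply: le_trans (main _ e1) _; rewrite lerD2l.
  by rewrite -mulrA ler_piMr ?(ltW e0)// mulrC ler_pdivrMr ?ltr_wpDl// mul1r lerDl.
move=> e0; have [L [Lminor Lclose]] := affine_minorants cf JI contf mM e0.
pose li (l : R * R) t := l.1 * t + l.2.
(* The weight of l is positive only where l is within e of f, so that the sign
condition on h_l (l - f + e) holds by construction. *)
pose w (l : R * R) t := Num.max 0 (li l t - f t + e).
pose W t := \sum_(l <- L) w l t.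
have cli l : {within J, continuous (li l)}.
  by apply: contD; [apply: contM; [exact: cont_cst|exact: cont_id]|exact: cont_cst].
have clfe l : {within J, continuous (fun t => li l t - f t + e)}.
  by apply: contD (@cont_cst _ J e); apply: contB.
have cw l : {within J, continuous (w l)} by apply: cont_max0.
have cW : {within J, continuous W} by apply: cont_sum.
have w0 l t : 0 <= w l t by rewrite le_max lexx.
have W0 t : J t -> 0 < W t.
  move=> /JP /Lclose[l lL hl]; rewrite /W (big_rem l lL)/=.
  apply: ltr_pwDl; last by apply: sumr_ge0.
  by rewrite /w lt_max /li; apply/orP; right; lra.
have cWV : {within J, continuous (fun t => (W t)^-1)}.
  apply/subspace_continuousP => t Jt; apply: cvgV; first by rewrite gt_eqF// W0.
  by move/subspace_continuousP: cW; apply.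
pose h (l : R * R) t := w l t * (W t)^-1.
have ch l : {within J, continuous (h l)} by apply: contM.
have h0 l t : J t -> 0 <= h l t by move=> /W0 Wt; rewrite divr_ge0 ?w0 ?ltW.
have csh l := cont_sqrt (ch l).
pose u l := rcalc Psi (fun t => Num.sqrt (h l t)).
have hu l : selfadjoint (u l) := rcalc_sa hy hPsi yJ (csh l).
have uu l : u l * u l = rcalc Psi (h l).
  by apply: (rcalc_sqrt hy hPsi yJ (ch l)) => t; apply: h0.
have u1 : \sum_(l <- L) u l * u l = 1.
  rewrite -(rcalc1 hPsi) (eq_bigr (fun l => rcalc Psi (h l))) //.
  rewrite -(rcalc_sum hy hPsi yJ)//.
  apply: (rcalc_ext hy hPsi yJ).
  - exact: cont_sum.
  - exact: cont_cst.
  - by move=> t /W0 Wt; rewrite /h -mulr_suml mulfV// gt_eqF.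
have hbe : cpos (b + sc e%:C) by apply: cposD => //; apply/cposC/ltW.
have -> : T b + e * T 1 = T (b + sc e%:C).
  rewrite TD//; last by apply/cposC/ltW.
  by rewrite TZ// ?(ltW e0)// -(mulr1 1); apply/cpos_sqr/sa1.
rewrite (cone_trace_pinching hu u1 hfy) (cone_trace_pinching hu u1 hbe).
rewrite big_seq [leRHS]big_seq.
apply: ler_sum => l lL; apply: cone_trace_le.
  by rewrite -{1}(hu l); apply: cpos_conj.
pose c := rcalc Psi (fun t => li l t - f t + e).
have cE : c = rcalc Psi (li l) - rcalc Psi f + sc e%:C.
  rewrite /c (rcalcD hy hPsi yJ); [|exact: contB|exact: cont_cst].
  by rewrite (rcalcB hy hPsi yJ)// (rcalc_cst hy hPsi yJ).
have -> : u l * (b + sc e%:C) * u l - u l * rcalc Psi f * u l =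
    star (u l) * (b - rcalc Psi (li l)) * u l + u l * c * u l.
  rewrite (hu l) -mulrBl -mulrBr -mulrDl -mulrDr; congr (_ * _ * _).
  by rewrite cE addrA addrA subrK addrAC.
apply: cposD.
- apply: cpos_conj.
  have -> : b - rcalc Psi (li l) = \sum_(i < n) star (a i) *
      rcalc (Phi i) (fun t => f t - li l t) * a i.
    rewrite (rcalc_affine hy hPsi yJ) -a1 !scaler_sumr -big_split/= -sumrB.
    apply: eq_bigr => i _.
    rewrite (rcalcB (hx i) (hPhi i) (xJ i))// (rcalc_affine (hx i) (hPhi i) (xJ i)).
    by rewrite mulrBr mulrBl mulrDr mulrDl !mulZr !mulZl mulr1.
  apply: cpos_sum => i _; apply: cpos_conj.
  apply: (rcalc_ge0 (hx i) (hPhi i) (xJ i)); first exact: contB.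
  by move=> t /JP mt; rewrite subr_ge0; apply: Lminor.
- rewrite /u /c -!(rcalcM hy hPsi yJ)//; last exact: contM.
  apply: (rcalc_ge0 hy hPsi yJ); first by apply: contM => //; apply: contM.
  move=> t Jt; rewrite mulrAC -expr2 sqr_sqrtr ?h0// /h mulrAC.
  apply: mulr_ge0; last by rewrite invr_ge0 ltW// W0.
  have [X0|X0] := leP 0 (li l t - f t + e); first by rewrite mulr_ge0.
  by rewrite /w max_l ?mul0r// ltW.
Qed.

End TraceJensen.

(** * The common spectral interval *)

Section SpectralHull.
Context {R : realType} {A : cstarAlgType R}.
Implicit Types (x y z : A) (t s : R).

Local Notation sc k := (k *: (1 : A)).

Lemma rspec_nonempty x : selfadjoint x -> (1 : A) != 0 -> rspec x !=set0.
Proof.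
move=> hx A0; have [x0|x0] := eqVneq x 0; last first.
  by have [h|h] := spec_norm hx x0; [exists (rn x)|exists (- rn x)].
exists 0; rewrite /rspec/= /spectrum/= x0 scale0r subr0 => -[y [h _]].
by move: A0; rewrite -h mul0r eqxx.
Qed.

(** As the spectrum lies in [-|x|, |x|], its points nearest to the two ends are
its extrema. *)
Lemma rspec_extrema x : selfadjoint x -> (1 : A) != 0 ->
  exists ts : R * R, [/\ rspec x ts.1, rspec x ts.2 &
    forall t, rspec x t -> ts.1 <= t <= ts.2].
Proof.
move=> hx A0; have x0 := rspec_nonempty hx A0.
have cK : compact (rspec x) by exact: rspec_compact.
have [m xm hm] := nearest_point (- rn x) cK x0.
have [M xM hM] := nearest_point (rn x) cK x0.
exists (m, M); split => // t xt /=.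
have := rspec_bound xt; have := rspec_bound xm; have := rspec_bound xM.
rewrite !ler_norml => /andP[b1 b2] /andP[b3 b4] /andP[b5 b6].
have := hM _ xt; rewrite !ler0_norm ?subr_le0// => h1.
have := hm _ xt; rewrite !opprK !ger0_norm -?lerBlDr ?sub0r// => h2.
by apply/andP; split; lra.
Qed.

Lemma rspec_hull n (x : 'I_n -> A) (I : set R) : (1 <= n)%N -> (1 : A) != 0 ->
  (forall i, selfadjoint (x i)) -> (forall i, spectrum_in (x i) I) ->
  exists m M, [/\ I m, I M, m <= M & forall i t, rspec (x i) t -> m <= t <= M].
Proof.
case: n x => // n x _ A0 hx xI.
have [i|ts hts] := @choice _ _ (fun i (ts : R * R) => [/\ rspec (x i) ts.1,
    rspec (x i) ts.2 & forall t, rspec (x i) t -> ts.1 <= t <= ts.2]).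
  exact: rspec_extrema.
have inI i t : rspec (x i) t -> I t by move: t; apply/spec_inP.
have [i0 _ hi0] := @arg_minP _ _ _ (@ord0 n) xpredT (fun i => (ts i).1) isT.
have [i1 _ hi1] := @arg_maxP _ _ _ (@ord0 n) xpredT (fun i => (ts i).2) isT.
exists (ts i0).1, (ts i1).2; split.
- by have [h _ _] := hts i0; apply: inI h.
- by have [_ h _] := hts i1; apply: inI h.
- have [_ h1 h2] := hts i0; have /andP[h3 _] := h2 _ h1.
  exact: le_trans h3 (hi1 i0 isT).
- move=> i t xt; have [_ _ /(_ _ xt)/andP[h1 h2]] := hts i.
  by rewrite (le_trans (hi0 i isT) h1) (le_trans h2 (hi1 i isT)).
Qed.

(** Shifting by a scalar commutes with the averaging, since the elements star (a
i) * a i add up to 1; so y - m and M - y are positive. *)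
Lemma rspec_conj_sum n (x a : 'I_n -> A) m M :
  (forall i, selfadjoint (x i)) -> (forall i t, rspec (x i) t -> m <= t <= M) ->
  \sum_(i < n) star (a i) * a i = 1 ->
  forall t, rspec (\sum_(i < n) star (a i) * x i * a i) t -> m <= t <= M.
Proof.
move=> hx xJ a1; set y := \sum_(i < n) _ => t yt.
have hy : selfadjoint y by apply: sa_sum => i _; apply: sa_conj.
have conj_sc k : sc k = \sum_(i < n) star (a i) * sc k * a i.
  rewrite -[in LHS]a1 scaler_sumr; apply: eq_bigr => i _.
  by rewrite mulZr mulr1 mulZl.
apply/andP; split.
- apply: (iffLR (cpos_Bscalar m hy)) yt.
  rewrite conj_sc -sumrB; apply: cpos_sum => i _.
  rewrite -mulrBl -mulrBr; apply: cpos_conj; apply/(cpos_Bscalar _ (hx i)).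
  by move=> s /xJ/andP[].
- apply: (iffLR (cpos_scalarB M hy)) yt.
  rewrite conj_sc -sumrB; apply: cpos_sum => i _.
  rewrite -mulrBl -mulrBr; apply: cpos_conj; apply/(cpos_scalarB _ (hx i)).
  by move=> s /xJ/andP[].
Qed.

(** The constant c serves to apply [trace_jensen_nonneg] to f + c when f takes
negative values. Adding it commutes with the averaging on both sides. *)
Lemma trace_jensen (T : A -> R) (I : set R) f n (x a : 'I_n -> A) :
  cone_trace T -> is_interval I -> convex_function I f -> {within I, continuous f} ->
  (1 <= n)%N -> (forall i, selfadjoint (x i)) -> (forall i, spectrum_in (x i) I) ->
  \sum_(k < n) star (a k) * a k = 1 -> (1 : A) != 0 ->
  let y := \sum_(i < n) star (a i) * x i * a i in
  let b := \sum_(i < n) star (a i) * cfc f (x i) * a i in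
  exists m M, [/\ I m, I M, m <= M & forall c : R,
    (forall t, m <= t <= M -> 0 <= f t + c) ->
    [/\ cpos (cfc f y + sc c%:C), cpos (b + sc c%:C) &
        T (cfc f y + sc c%:C) <= T (b + sc c%:C)]].
Proof.
move=> hT I_itv cf contf n1 hx xI a1 A0 y b.
have [m [M [Im IM mM xJ]]] := rspec_hull n1 A0 hx xI.
have yJ := rspec_conj_sum hx xJ a1; rewrite -/y in yJ.
have JI t : m <= t <= M -> I t by apply: I_itv.
have hy : selfadjoint y by apply: sa_sum => i _; apply: sa_conj.
have [Psi hPsi PsiE] := cfcP f hy.
have [i|Phi hPhi] := @choice _ _ (fun i Phi => functional_calculus (x i) Phi /\
    cfc f (x i) = rcalc Phi f).
  by have [Phi h1 h2] := cfcP f (hx i); exists Phi.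
have contJ : {within `[m, M], continuous f}.
  by apply: continuous_subspaceW contf => t; rewrite /= in_itv; apply: JI.
have xJ' i t : rspec (x i) t -> `[m, M]%classic t by rewrite /= in_itv; apply: xJ.
have yJ' t : rspec y t -> `[m, M]%classic t by rewrite /= in_itv; apply: yJ.
exists m, M; split => // c fc0.
pose g t := f t + c.
have contg : {within `[m, M], continuous g} by apply: contD contJ (@cont_cst _ _ c).
have cg : convex_function I g.
  move=> p u v uI vI; have := cf p u v uI vI.
  rewrite !convRE /g => h.
  have -> : p%:num * (f u + c) + unstable.onem p%:num * (f v + c) =
      p%:num * f u + unstable.onem p%:num * f v + c.
    by rewrite /unstable.onem; ring.
  by rewrite lerD2r.
have gE z Phi' : selfadjoint z -> functional_calculus z Phi' ->
    (forall t, rspec z t -> `[m, M]%classic t) ->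
    rcalc Phi' g = rcalc Phi' f + sc c%:C.
  move=> hz hP zJ; rewrite (rcalcD hz hP zJ)//; last exact: cont_cst.
  by rewrite (rcalc_cst hz hP zJ).
have yE : cfc f y + sc c%:C = rcalc Psi g by rewrite (gE y)// PsiE.
have bE : b + sc c%:C = \sum_(i < n) star (a i) * rcalc (Phi i) g * a i.
  rewrite -a1 scaler_sumr -big_split/=; apply: eq_bigr => i _.
  have [h1 h2] := hPhi i; rewrite (gE (x i))//; last exact: xJ'.
  by rewrite h2 mulrDr mulrDl mulZr mulr1 mulZl.
have g0 t : `[m, M]%classic t -> 0 <= g t by rewrite /= in_itv; apply: fc0.
rewrite yE bE; split.
- exact: (rcalc_ge0 hy hPsi yJ').
- apply: cpos_sum => i _; apply: cpos_conj; have [h1 _] := hPhi i.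
  exact: (rcalc_ge0 (hx i) h1 (xJ' i)).
- apply: (trace_jensen_nonneg hT cg JI contg mM fc0 hx xJ' yJ' a1) => //.
  by move=> i; have [] := hPhi i.
Qed.

End SpectralHull.

(** * Finite traces and densely defined traces *)

Section Traces.
Context {R : realType} {A : cstarAlgType R}.
Implicit Types (x y z : A) (t s : R).

Local Notation sc k := (k *: (1 : A)).

Lemma all_eq_trivial : (1 : A) = 0 -> forall x y, x = y.
Proof. by move=> h x y; rewrite -[x]mulr1 -[y]mulr1 h !mulr0. Qed.

(** h is the difference of the positive elements |h| and |h| - h. *)
Lemma finite_trace_real (tau : {scalar A}) h : finite_trace tau -> selfadjoint h ->
  complex.Im (tau h) = 0.
Proof.
move=> [tau0 _] hs.
have h1 : cpos (sc (rn h)%:C - h) by apply: cpos_rn_sub.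
have h2 : cpos (sc (rn h)%:C) by apply/cposC/rn_ge0.
have -> : h = sc (rn h)%:C - (sc (rn h)%:C - h) by rewrite opprB addrC subrK.
rewrite raddfB raddfB /= !ger0_Im ?subrr//; exact: tau0.
Qed.

(** A positive z of finite trace with |1 - z| < 1/2 exists by density. Then |1 -
(2 z - 1)| <= 1, so 2 z - 1 is positive and the trace of 1 is at most twice that
of z; and x <= |x| 1. *)
Lemma ext_trace_fin (tau : A -> \bar R) x : ext_trace tau -> densely_defined tau ->
  cpos x -> tau x \is a fin_num.
Proof.
move=> [tau0 tauD tauZ _] dd hx.
have c1 : cpos (1 : A) by rewrite -[1](scale1r (1 : A)) -[1]/((1 : R)%:C); apply: cposC.
have h0 : 0 < (2^-1 : R)%:C :> R[i] by rewrite ltcR invr_gt0.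
have [z [[hz zfin] /=]] := dd _ c1 _ (nbhsx_ballx (1 : A) _ h0).
rewrite -ball_normE/= rnE ltcR => z1.
have hz2 : cpos (2%:C *: z) by apply: cposZ.
have d1 : cpos (2%:C *: z - 1).
  apply: (@cposP_rnB _ _ _ 1).
    by apply: saB (cpos_sa hz2) _; exact: sa1.
  have -> : sc (1 : R)%:C - (2%:C *: z - 1) = 2%:C *: (1 - z).
    by rewrite scale1r scalerBr opprB addrA rmorph_nat !scaler_nat mulr2n.
  by rewrite rnZ rnR ger0_norm//; lra.
have fin1 : (tau 1%R < +oo)%E.
  have e : tau (2%:C *: z) = (tau 1%R + tau (2%:C *: z - 1)%R)%E.
    by rewrite -tauD// addrC subrK.
  have lt : (tau (2%:C *: z) < +oo)%E.
    by rewrite tauZ// lte_mul_pinfty// lee_fin.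
  by apply: le_lt_trans lt; rewrite e leeDl// tau0.
rewrite ge0_fin_numE ?tau0//.
have d2 : cpos (sc (rn x)%:C - x) by apply: cpos_rn_sub => //; apply: cpos_sa.
have e : tau (sc (rn x)%:C) = (tau x + tau (sc (rn x)%:C - x)%R)%E.
  by rewrite -tauD// addrC subrK.
apply: (@le_lt_trans _ _ (tau (sc (rn x)%:C))); first by rewrite e leeDl// tau0.
by rewrite tauZ ?rn_ge0// lte_mul_pinfty// ?lee_fin ?rn_ge0.
Qed.

End Traces.

Theorem theorem2p7 (R : realType) (I : set R) (f : R -> R)
    (I_itv : is_interval I)
    (f_convex : convex_function I f)
    (f_cont : {within I, continuous f})
    (A : cstarAlgType R) :
  (forall tau : {scalar A}, finite_trace tau ->
    forall (n : nat) (x a : 'I_n -> A), (1 <= n)%N ->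
      (forall i, selfadjoint (x i)) ->
      (forall i, spectrum_in (x i) I) ->
      \sum_(k < n) star (a k) * a k = 1 ->
      tau (cfc f (\sum_(i < n) star (a i) * x i * a i))
        <= tau (\sum_(i < n) star (a i) * cfc f (x i) * a i))
  /\
  (forall tau : A -> \bar R, ext_trace tau -> lsc_trace tau ->
    densely_defined tau -> (forall t, I t -> 0 <= f t) ->
    forall (n : nat) (x a : 'I_n -> A), (1 <= n)%N ->
      (forall i, selfadjoint (x i)) ->
      (forall i, spectrum_in (x i) I) ->
      \sum_(k < n) star (a k) * a k = 1 ->
      (tau (cfc f (\sum_(i < n) star (a i) * x i * a i)%R)
        <= tau (\sum_(i < n) star (a i) * cfc f (x i) * a i)%R)%E).
Proof.
split.
- move=> tau htau n x a n1 hx xI a1.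
  have [A0|A0] := eqVneq (1 : A) 0.
    by rewrite (all_eq_trivial A0 (cfc f _)
      (\sum_(i < n) star (a i) * cfc f (x i) * a i)).
  have [tau0 tauC] := htau.
  have hT : cone_trace (fun z => complex.Re (tau z)).
    split; first by move=> z /tau0; rewrite lecE => /andP[].
    - by move=> y z _ _; rewrite raddfD raddfD.
    - by move=> t z _ _; rewrite linearZ/=; case: (tau z) => p q /=; rewrite mul0r subr0.
    - by move=> z; rewrite tauC.
  have [m [M [Im IM mM h]]] :=
    trace_jensen hT I_itv f_convex f_cont n1 hx xI a1 A0.
  set y := \sum_(i < n) _ in h *; set b := \sum_(i < n) _ in h *.
  have contJ : {within `[m, M], continuous f}.
    apply: continuous_subspaceW f_cont => t; rewrite /= in_itv.
    exact: (I_itv _ _ Im IM).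
  have [t0 _ ht0] := EVT_min mM contJ.
  have [|h1 h2 h3] := h (- f t0).
    by move=> t mt; rewrite subr_ge0; apply: ht0; rewrite in_itv.
  have hs : selfadjoint ((- f t0)%:C *: (1 : A)) by exact: saC.
  have sy : selfadjoint (cfc f y).
    by rewrite -[cfc f y](addrK ((- f t0)%:C *: (1 : A))); apply: saB hs; apply: cpos_sa.
  have sb : selfadjoint b.
    by rewrite -[b](addrK ((- f t0)%:C *: (1 : A))); apply: saB hs; apply: cpos_sa.
  rewrite lecE !(finite_trace_real htau)// eqxx/=.
  by move: h3; rewrite !raddfD/= lerD2r.
- move=> tau htau _ dd f0 n x a n1 hx xI a1.
  have [A0|A0] := eqVneq (1 : A) 0.
    by rewrite (all_eq_trivial A0 (cfc f _)
      (\sum_(i < n) star (a i) * cfc f (x i) * a i)).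
  have fin z := @ext_trace_fin R A tau z htau dd.
  have hT : cone_trace (fun z => fine (tau z)).
    split; first by move=> z hz; apply/fine_ge0/(ext_trace_ge0 htau).
    - by move=> y z hy hz; rewrite (ext_traceD htau)// fineD ?fin.
    - by move=> t z t0 hz; rewrite (ext_traceZ htau)// fineM ?fin.
    - by move=> z; rewrite (ext_trace_star htau).
  have [m [M [Im IM mM h]]] :=
    trace_jensen hT I_itv f_convex f_cont n1 hx xI a1 A0.
  have [|h1 h2 h3] := h 0.
    by move=> t mt; rewrite addr0; apply: f0; apply: (I_itv _ _ Im IM).
  move: h1 h2 h3; rewrite scale0r !addr0 => h1 h2 h3.
  by rewrite -(fineK (fin _ h1)) -(fineK (fin _ h2)) lee_fin.
Qed.
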